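(* Let ${\bf v} \in \mathbb{R}^{|\mathcal{T}_3|}$ with ${\bf v}(T_3) = 1$ and ${\bf v}(C_3) = 0$. Then $\nu_{\bf v} \ge \frac{85}{98}$. In particular, for all $n \equiv 1,3 \pmod 6$, every tournament on $n$ vertices has a triangle decomposition where the number of copies of $C_3$ in the decomposition is at most $\frac{13}{98\cdot 6} n^2(1+o_n(1))$.
   Context: $\mathcal{T}_3 = \{T_3, C_3\}$ where $T_3$ is the transitive tournament on 3 vertices and $C_3$ is the directed (cyclic) triangle. A triangle decomposition ($3$-decomposition) $L$ of a tournament $G$ on $n$ vertices is a set of 3-vertex subtournaments such that every pair of vertices lies in exactly one of them; $\nu_{\bf v}(L)$ is the fraction of elements of $L$ that are copies of $T_3$ (for this ${\bf v}$); $\nu_{\bf v}(G) = \max_L \nu_{\bf v}(L)$; $\nu_{\bf v}(n)$ is the minimum of $\nu_{\bf v}(G)$ over $n$-vertex tournaments when $n \equiv 1,3 \pmod 6$, and otherwise $\nu_{\bf v}(m)$ for the largest $m \le n$ with $m \equiv 1,3 \pmod 6$; $\nu_{\bf v} = \lim_{n\to\infty}\nu_{\bf v}(n)$. *)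

(* Defs.v *)
From mathcomp Require Import all_boot all_order all_algebra.
From mathcomp Require Import all_classical all_reals all_analysis.
Set Implicit Arguments.
Unset Strict Implicit.
Unset Printing Implicit Defensive.
Import Order.TTheory GRing.Theory Num.Theory.
Import numFieldNormedType.Exports.
Local Open Scope classical_set_scope.
Local Open Scope ring_scope.

Definition tournament (T : finType) (G : rel T) : Prop :=
  irreflexive G /\ forall x y : T, x != y -> G x y = ~~ G y x.

(** The family of 3-vertex tournaments up to isomorphism: a vector indexed by
    it is a function [tri -> R]. *)
Variant tri := T3 | C3.

Definition tri_rel (H : tri) : rel 'I_3 :=
  match H with
  | T3 => fun i j => (i < j)%N
  | C3 => fun i j => j == (i.+1 %% 3)%N :> nat
  end.

(** [t] induces in [G] a copy of [H]. *)
Definition is_copy (T : finType) (G : rel T) (H : tri) (t : {set T}) : bool :=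
  [exists f : {ffun 'I_3 -> T},
    [&& injectiveb f,
        [set f i | i : 'I_3]%SET == t
      & [forall i, forall j, G (f i) (f j) == tri_rel H i j]]].

(** Subtournaments are induced, so they are represented by their vertex sets. *)
Definition triangle_decomposition (T : finType) (L : {set {set T}}) : Prop :=
  (forall t, t \in L -> #|t| = 3%N) /\
  (forall x y : T, x != y ->
     #|[set t in L | (x \in t) && (y \in t)]%SET| = 1%N).

Definition num_copies (T : finType) (G : rel T) (H : tri)
    (L : {set {set T}}) : nat :=
  #|[set t in L | is_copy G H t]%SET|.

Section Nu.
Context {R : realType}.
Implicit Type v : tri -> R.

Definition nu_dec v (T : finType) (G : rel T) (L : {set {set T}}) : R :=
  v T3 * ((num_copies G T3 L)%:R / #|L|%:R) +
  v C3 * ((num_copies G C3 L)%:R / #|L|%:R).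

(** The sets below are finite, so [sup] and [inf] are a maximum and a minimum
    (triangle decompositions exist when [#|T|] is 1 or 3 modulo 6). *)
Definition nu_tournament v (T : finType) (G : rel T) : R :=
  sup [set nu_dec v G L | L in [set L | triangle_decomposition L]].

Definition nu_min v (n : nat) : R :=
  inf [set nu_tournament v G | G in [set G : rel 'I_n | tournament G]].

Definition admissible (n : nat) : bool :=
  (n == 1 %[mod 6])%N || (n == 3 %[mod 6])%N.

(** The largest admissible [m <= n] (and 0 for [n = 0], where there is none). *)
Definition admissible_floor (n : nat) : nat :=
  (\max_(m < n.+1 | admissible m) m)%N.

Definition nu_seq v (n : nat) : R :=
  if admissible n then nu_min v n else nu_min v (admissible_floor n).

Definition nu v : R := limn (nu_seq v).

End Nu.

(* Main.v *)
(* Deleting from the transversal design over [Z_q] a few parallel classes of lines and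
   the end of one group, and giving weight 6 to its points, shows that for fixed
   admissible [k] and every large admissible [m] the pairs of an [m]-set can be
   partitioned into [k]-sets and triples so that the [k]-sets cover a proportion
   at least [1 - 1/k - o(1)] of the pairs. Filling the [k]-sets optimally gives
   [nu(m) >= (1 - 1/k - o(1)) nu(k)], hence convergence to the supremum of
   [(1 - 1/k) nu(k)].

   For [m = 7^d] the pairs are partitioned into 7-sets, each of which is filled with
   its best Fano plane. A sum-of-squares certificate over the 4-vertex tournaments
   rooted at a vertex (a flag algebra argument, checked on all tournaments on seven
   vertices with a prescribed Hamiltonian path) shows that a random 7-set of a
   tournament has a Fano plane with at most [13/14 + O(1/m)] cyclic lines on
   average, so [nu(7^d) >= 1 - 13/98 - O(7^-d)]. *)

From Stdlib Require Import ZArith.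
Require Import Defs.
From mathcomp Require Import all_boot all_order all_algebra.
From mathcomp Require Import all_classical all_reals all_analysis.
From mathcomp Require Import fingroup perm zify ssrZ lra.
Set Implicit Arguments.
Unset Strict Implicit.
Unset Printing Implicit Defensive.
Import Order.TTheory GRing.Theory Num.Theory.
Import numFieldNormedType.Exports.
Local Open Scope classical_set_scope.
Local Open Scope ring_scope.

(** * Decompositions into blocks and triples *)

Local Open Scope nat_scope.

(** No design with all blocks of size k is assumed to exist on m points for general admissible m:
    every design used is explicit, and the pairs it does not put into k-sets are left to triples
    that may all turn out cyclic. The loss of 1/k is the share of the pairs inside the k groups of a
    transversal design, which are covered by triples only; it vanishes as k grows, and this is
    enough for convergence. Hence the numerical bound is needed only along one sequence, and 7^d is
    chosen because there the 7-sets cover all pairs exactly. The weight 6 is dictated by m = 6a + c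
    with c = 1 or 3: a group of 6y points together with c points common to all groups has admissible
    size, so it carries a Steiner triple system. At most 13/14 cyclic lines among the 7 lines of a
    Fano plane give the constant 13/98. Only the average over all 7-sets is controlled, so the
    design is placed on the tournament by a permutation that does at least as well as a random
    one. *)

Definition cover (T : eqType) (B : seq (seq T)) (x y : T) : nat :=
  \sum_(b <- B) ((x \in b) && (y \in b)).

Definition blocks (T : eqType) (k : nat) (B : seq (seq T)) : bool :=
  all (fun b => uniq b && (size b == k)) B.

(** An edge decomposition of the multigraph with multiplicities [e] into exactly [n] copies of K_k
    and any number of triangles; for [n = 0] only triangles occur. Multiplicities in [nat], instead
    of a relation, let decompositions be added and summed. *)
Definition dec (T : eqType) (k n : nat) (e : T -> T -> nat) : Prop :=
  exists L M : seq (seq T), [/\ blocks k L, blocks 3 M, size L = n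
    & forall x y, x != y -> cover L x y + cover M x y = e x y].

(** Group divisible design of type [w^u]: [u] groups of [w] points. Its companion [pbd] is a
    pairwise balanced design, a Steiner triple system when [n = 0]. *)
Definition gdd (k n u w : nat) : Prop :=
  dec k n (fun x y : 'I_u * 'I_w => (x.1 != y.1) : nat).

Definition pbd (k n v : nat) : Prop :=
  dec k n (fun _ _ : 'I_v => 1%N).

Lemma sum_nat_uniq (I : finType) (P : pred I) (i : I) :
  P i -> (forall j, P j -> j = i) -> \sum_j (P j : nat) = 1%N.
Proof.
move=> Pi u; rewrite (bigD1 i) //= Pi big1 // => j /negP nij.
by case: (boolP (P j)) => // /u /eqP.
Qed.

Lemma sum_nat_none (I : finType) (P : pred I) :
  (forall j, ~~ P j) -> \sum_j (P j : nat) = 0%N.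
Proof. by move=> n; rewrite big1 // => j _; rewrite (negPf (n j)). Qed.

Lemma cover_cat (T : eqType) (A B : seq (seq T)) x y :
  cover (A ++ B) x y = cover A x y + cover B x y.
Proof. by rewrite /cover big_cat. Qed.

Lemma cover_map (T T' : eqType) (f : T -> T') (B : seq (seq T)) x y :
  injective f -> cover (map (map f) B) (f x) (f y) = cover B x y.
Proof.
by move=> fI; rewrite /cover big_map; apply: eq_bigr => b _; rewrite !mem_map.
Qed.

Lemma cover_map0 (T T' : eqType) (f : T -> T') (B : seq (seq T)) x y :
  (forall a, f a != x) \/ (forall a, f a != y) ->
  cover (map (map f) B) x y = 0.
Proof.
move=> h; rewrite /cover big_map big1 // => b _.
case: (boolP (x \in _)) => //= /mapP[a _ xa].
case: (boolP (y \in _)) => //= /mapP[a' _ ya].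
by case: h => h; [have := h a | have := h a']; rewrite -?xa -?ya eqxx.
Qed.

Lemma blocks_map (T T' : eqType) (f : T -> T') k (B : seq (seq T)) :
  injective f -> blocks k (map (map f) B) = blocks k B.
Proof.
move=> fI; rewrite /blocks all_map; apply: eq_all => b /=.
by rewrite map_inj_uniq // size_map.
Qed.

Lemma dec_ext (T : eqType) k n (e e' : T -> T -> nat) :
  (forall x y, x != y -> e x y = e' x y) -> dec k n e -> dec k n e'.
Proof.
move=> E [L [M [hL hM hs c]]]; exists L, M; split=> // x y xy.
by rewrite c // E.
Qed.

Lemma dec0 (T : eqType) k : dec k 0 (fun _ _ : T => 0).
Proof. by exists [::], [::]; split=> // x y _; rewrite /cover !big_nil. Qed.

Lemma decD (T : eqType) k n1 n2 (e1 e2 : T -> T -> nat) :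
  dec k n1 e1 -> dec k n2 e2 ->
  dec k (n1 + n2) (fun x y => e1 x y + e2 x y).
Proof.
move=> [L1 [M1 [a1 b1 s1 c1]]] [L2 [M2 [a2 b2 s2 c2]]].
exists (L1 ++ L2), (M1 ++ M2); split.
- by rewrite /blocks all_cat; apply/andP.
- by rewrite /blocks all_cat; apply/andP.
- by rewrite size_cat s1 s2.
- by move=> x y xy; rewrite !cover_cat addnACA c1 // c2.
Qed.

Lemma dec_sum (I : Type) (r : seq I) (P : pred I) (T : eqType) k
    (n : I -> nat) (e : I -> T -> T -> nat) :
  (forall i, P i -> dec k (n i) (e i)) ->
  dec k (\sum_(i <- r | P i) n i) (fun x y => \sum_(i <- r | P i) e i x y).
Proof.
move=> h; elim: r => [|i r IH].
  by rewrite big_nil; apply: dec_ext (dec0 T k) => x y _; rewrite big_nil.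
rewrite big_cons; case: ifP => Pi.
  by apply: dec_ext (decD (h i Pi) IH) => x y _; rewrite big_cons Pi.
by apply: dec_ext IH => x y _; rewrite big_cons Pi.
Qed.

Lemma dec_sum0 (I : Type) (r : seq I) (P : pred I) (T : eqType) k
    (e : I -> T -> T -> nat) :
  (forall i, P i -> dec k 0 (e i)) ->
  dec k 0 (fun x y => \sum_(i <- r | P i) e i x y).
Proof. by move=> /(dec_sum r); rewrite big1. Qed.

Lemma dec_map (T T' : eqType) (f : T -> T') k n (e : T -> T -> nat)
    (e' : T' -> T' -> nat) :
  injective f ->
  (forall a b, a != b -> e' (f a) (f b) = e a b) ->
  (forall x y, x != y -> (forall a, f a != x) \/ (forall a, f a != y) ->
     e' x y = 0) ->
  (forall x, (exists a, f a = x) \/ (forall a, f a != x)) ->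
  dec k n e -> dec k n e'.
Proof.
move=> fI h1 h0 cl [L [M [a b s c]]].
exists (map (map f) L), (map (map f) M); split; rewrite ?blocks_map ?size_map //.
move=> x y xy; case: (cl x) => [[u xu]|nx]; last first.
  by rewrite !cover_map0 ?h0 //; left.
case: (cl y) => [[v yv]|ny]; last by rewrite !cover_map0 ?h0 //; right.
move: xy; rewrite -xu -yv (inj_eq fI) => uv.
by rewrite !cover_map // c // h1.
Qed.

Lemma dec_mapF (T : finType) (T' : eqType) (f : T -> T') k n (e : T -> T -> nat)
    (e' : T' -> T' -> nat) :
  injective f ->
  (forall a b, a != b -> e' (f a) (f b) = e a b) ->
  (forall x y, x != y -> (forall a, f a != x) \/ (forall a, f a != y) ->
     e' x y = 0) ->
  dec k n e -> dec k n e'.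
Proof.
move=> fI h1 h0; apply: (dec_map fI h1 h0) => x.
case: (boolP [exists a, f a == x]) => [/existsP[a /eqP]|/existsPn]; last by right.
by left; exists a.
Qed.

Lemma dec_bij (T T' : finType) (f : T -> T') k n (e : T -> T -> nat)
    (e' : T' -> T' -> nat) :
  bijective f -> (forall a b, a != b -> e' (f a) (f b) = e a b) ->
  dec k n e -> dec k n e'.
Proof.
move=> fB h; apply: (dec_mapF (bij_inj fB) h) => x y _.
by case: fB => g gK fK [] hh; [have := hh (g x)|have := hh (g y)]; rewrite fK eqxx.
Qed.

Lemma dec_line (T : eqType) k (b : seq T) : uniq b -> size b = k ->
  dec k 1 (fun x y => (x \in b) && (y \in b)).
Proof.
move=> u s; exists [:: b], [::]; split=> //=; first by rewrite /blocks /= u s eqxx.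
by move=> x y _; rewrite /cover big_seq1 big_nil addn0.
Qed.

Lemma dec_tri (T : eqType) k (b : seq T) : uniq b -> size b = 3 ->
  dec k 0 (fun x y => (x \in b) && (y \in b)).
Proof.
move=> u s; exists [::], [:: b]; split=> //=; first by rewrite /blocks /= u s eqxx.
by move=> x y _; rewrite /cover big_seq1 big_nil.
Qed.

Lemma dec_completeP k n (T : finType) :
  pbd k n #|T| <-> dec k n (fun _ _ : T => 1%N).
Proof.
split; last by apply: dec_bij => //; exists enum_val; [apply: enum_rankK | apply: enum_valK].
by apply: dec_bij => //; exists enum_rank; [apply: enum_valK | apply: enum_rankK].
Qed.

Lemma gddP k n (U W : finType) :
  gdd k n #|U| #|W| <-> dec k n (fun x y : U * W => (x.1 != y.1) : nat).
Proof.
split.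
  apply: (dec_bij (f := fun p => (enum_val p.1, enum_val p.2))).
    exists (fun p => (enum_rank p.1, enum_rank p.2)) => -[a b] /=;
    by rewrite ?enum_valK ?enum_rankK.
  by move=> a b _ /=; rewrite (inj_eq enum_val_inj).
apply: (dec_bij (f := fun p => (enum_rank p.1, enum_rank p.2))).
  exists (fun p => (enum_val p.1, enum_val p.2)) => -[a b] /=;
  by rewrite ?enum_valK ?enum_rankK.
by move=> a b _ /=; rewrite (inj_eq enum_rank_inj).
Qed.

(** * Steiner triple systems and group divisible designs *)

Lemma dec_indexed (T : eqType) (I : finType) (P : pred I) k (t : I -> seq T)
    (e : T -> T -> nat) :
  (forall i, P i -> uniq (t i) && (size (t i) == 3)) ->
  (forall x y, x != y -> \sum_i [&& P i, x \in t i & y \in t i] = e x y) ->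
  dec k 0 e.
Proof.
move=> ht he; have := @dec_sum0 _ (index_enum I) P T k
  (fun i x y => (x \in t i) && (y \in t i)) _.
move/(_ (fun i Pi => dec_tri k (proj1 (andP (ht i Pi))) (eqP (proj2 (andP (ht i Pi)))))).
apply: dec_ext => x y xy; rewrite -he // [LHS]big_mkcond /=.
by apply: eq_bigr => i _; case: (P i).
Qed.

Lemma ordS3 (i j : 'I_3) : [|| j == i, j == ordS i | i == ordS j].
Proof. by move: i j => [[|[|[|i]]] hi] [[|[|[|j]]] hj]. Qed.

Lemma ordS3_neq (i : 'I_3) : (ordS i == i = false) * (i == ordS i = false) *
  (ordS (ordS i) == i = false) * (i == ordS (ordS i) = false) *
  (ordS (ordS i) == ordS i = false).
Proof. by move: i => [[|[|[|i]]] hi]; do !split. Qed.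

Section Quasigroup.
Variables (n : nat) (op : 'I_n -> 'I_n -> 'I_n).
Hypotheses (opC : commutative op) (opI : forall x, injective (op x)).

(** The pairs covered by the Bose triples {(a,i), (b,i), (ab,i+1)} with a and b distinct: all pairs
    except those joining (x,i) to (xx,i+1). An idempotent operation thus leaves the groups {(x,0),
    (x,1), (x,2)}. *)
Definition quasi_graph (p q : 'I_n * 'I_3) : nat :=
  if p.2 == q.2 then p.1 != q.1
  else if q.2 == ordS p.2 then q.1 != op p.1 p.1 else p.1 != op q.1 q.1.

Lemma quasi_dec k : dec k 0 quasi_graph.
Proof.
pose t (i : 'I_n * 'I_n * 'I_3) := [:: (i.1.1, i.2); (i.1.2, i.2); (op i.1.1 i.1.2, ordS i.2)].
pose P (i : 'I_n * 'I_n * 'I_3) := i.1.1 < i.1.2.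
apply: (@dec_indexed _ _ P k t) => [[[a b] j]|].
  rewrite /P /= => ab; rewrite !inE !xpair_eqE !ordS3_neq !andbF !eqxx !orbF !andbT.
  by apply/negP => /eqP abE; rewrite abE ltnn in ab.
have main x i y j : (x, i) != (y, j) -> (j == i) || (j == ordS i) ->
  \sum_m [&& P m, (x, i) \in t m & (y, j) \in t m] = quasi_graph (x, i) (y, j).
  rewrite /quasi_graph /=.
  case: (eqVneq i j) => [<-|nij] /=.
    rewrite xpair_eqE eqxx andbT => nxy _.
    have nV : (val x == val y) = false by apply: negbTE.
    rewrite nxy.
    apply: (@sum_nat_uniq _ _ ((if x < y then (x, y) else (y, x)), i)).
      rewrite /P /t /=; case: (ltngtP x y) => /= [xy|xy|/eqP]; last by rewrite nV.
        by rewrite xy !inE !eqxx ?orbT.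
      by rewrite xy !inE !eqxx ?orbT.
    move=> [[a b] l] /and3P[]; rewrite /P /= !inE !xpair_eqE => ab.
    move=> /or3P[]/andP[/eqP xE /eqP iE] /or3P[]/andP[/eqP yE /eqP jE]; subst x y i;
      try by [rewrite eqxx in nxy | move/eqP: jE; rewrite !ordS3_neq].
      by rewrite ab.
    by rewrite ltnNge ltnW.
  move=> _ /eqP ->; rewrite eqxx.
  (* A triple through (x,i) and (y,i+1) must come from x and the solution [g y] of [op x z = y]; it
     exists unless this solution is x itself. *)
  have [g gK] : exists g, cancel g (op x).
    by have [g _ gK] := injF_bij (@opI x); exists g.
  case: (eqVneq y (op x x)) => [->|nyx] /=.
    apply: sum_nat_none => -[[a b] l]; apply/negP => /and3P[]; rewrite /P /= => ab.
    rewrite !inE !xpair_eqE => /or3P[]/andP[/eqP xE /eqP iE] /or3P[]/andP[/eqP yE /eqP jE];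
      subst x i; try by move/eqP: jE; rewrite !ordS3_neq.
      by move: yE => /opI /= E; rewrite E ltnn in ab.
    by move: yE; rewrite (opC a) => /opI /= E; rewrite E ltnn in ab.
  have nz : val (g y) <> val x.
    by move/val_inj => E; move: nyx; rewrite -{2}E gK eqxx.
  apply: (@sum_nat_uniq _ _ ((if x < g y then (x, g y) else (g y, x)), i)).
    rewrite /P /t /=; case: (ltngtP x (g y)) => /= [xy|xy|/esym//].
      by rewrite xy !inE gK !eqxx ?orbT.
    by rewrite xy !inE opC gK !eqxx ?orbT.
  move=> [[a b] l] /and3P[]; rewrite /P /= !inE !xpair_eqE => ab.
  move=> /or3P[]/andP[/eqP xE /eqP iE] /or3P[]/andP[/eqP yE /eqP jE];
      subst x i; try by move/eqP: jE; rewrite !ordS3_neq.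
    rewrite /= in gK yE *; have -> : g y = b by apply: (@opI a); rewrite gK yE.
    by rewrite ab.
  rewrite /= in gK yE *; have -> : g y = a by apply: (@opI b); rewrite gK yE opC.
  by rewrite ltnNge ltnW.
case=> x i [y j] nxy; have [h|h] := boolP ((j == i) || (j == ordS i)); first exact: main.
have h' : i == ordS j by move: h; have := ordS3 i j; case: (j == i); case: (j == _).
under eq_bigr do rewrite [((x, i) \in _) && _]andbC.
rewrite main //; last 2 first; first by rewrite eq_sym.
- by rewrite h' orbT.
move/eqP: h' => iE; rewrite /quasi_graph /= iE !ordS3_neq eqxx /=.
by [].
Qed.
End Quasigroup.

(** The midpoint (x + y)/2 in Z_n for n = 2t + 1, where [t.+1] is the inverse of 2. *)
Lemma mid_op t : exists op : 'I_t.*2.+1 -> 'I_t.*2.+1 -> 'I_t.*2.+1,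
  [/\ commutative op, forall x, injective (op x) & forall x, op x x = x].
Proof.
pose n := t.*2.+1.
pose op (x y : 'I_n) : 'I_n := inZp ((x + y) * t.+1).
have cp : coprime n t.+1.
  have -> : n = (t.+1).*2 - 1 by rewrite /n; lia.
  rewrite coprime_sym; apply/coprimeP => //; exists (2, 1); rewrite /= -mul2n; lia.
exists op; split=> [x y|x y z|x].
- by rewrite /op addnC.
- move=> /(congr1 val)/eqP /=; rewrite -[_ == _]/(_ == _ %[mod n]).
  wlog yz : y z / z <= y.
    by move=> W; case: (leqP z y) => [|/ltnW] h; [exact: W | rewrite eq_sym => /(W _ _ h)].
  rewrite eqn_mod_dvd; last by rewrite leq_mul2r leq_add2l yz orbT.
  rewrite -mulnBl subnDl Gauss_dvdl // => /dvdnP[[|m] E].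
    by apply: val_inj; apply/eqP; rewrite /= eqn_leq yz -subn_eq0 E mul0n.
  by have := ltn_ord y; rewrite -/n; move: E; rewrite mulSn; lia.
apply: val_inj; rewrite /= addnn -mul2n mulnAC.
have -> : 2 * t.+1 = n + 1 by rewrite /n; lia.
by rewrite mulnDl mul1n [n * _]mulnC modnMDl modn_small.
Qed.

Lemma bose k t : gdd k 0 t.*2.+1 3.
Proof.
have [op [opC opI opx]] := mid_op t.
apply: dec_ext (quasi_dec opC opI k) => -[x i] [y j] nxy.
rewrite /quasi_graph /= !opx; case: eqP => // _; case: eqP => // _.
by rewrite eq_sym.
Qed.

Section Skolem.
Variables (t k : nat).
Local Notation n := (t.*2).

Lemma half_op_proof (x y : 'I_n) :
  (let z := (x + y) %% n in if odd z then t + z./2 else z./2) < n.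
Proof.
have n0 : 0 < n by case: (n) x => // -[].
have /= := ltn_pmod (x + y) n0; set z := _ %% _.
by case: ifP; lia.
Qed.
(** Addition in Z_2t followed by the bijection 2j -> j, 2j + 1 -> t + j. It is half-idempotent: for
    x < t both x and x + t have square x. *)
Definition half_op (x y : 'I_n) : 'I_n := Ordinal (half_op_proof x y).

Lemma half_opC : commutative half_op.
Proof. by move=> x y; apply: val_inj; rewrite /= addnC. Qed.

Lemma half_opI x : injective (half_op x).
Proof.
move=> y z /(congr1 val) /=.
have n0 : 0 < n by case: (n) x => // -[].
have hy := ltn_pmod (x + y) n0; have hz := ltn_pmod (x + z) n0 => E.
have {E} E : (x + y) %% n = (x + z) %% n.
  move: E hy hz; move: (_ %% _) (_ %% _) => a b.
  by case: ifP => ?; case: ifP => ?; lia.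
apply: val_inj => /=.
by move/eqP: E; rewrite eqn_modDl !modn_small // => /eqP.
Qed.

Lemma half_opxx (x : 'I_n) : (half_op x x : nat) = (if x < t then (x : nat) else x - t).
Proof.
have hx := ltn_ord x; rewrite /= addnn; case: ltnP => xt.
  by rewrite modn_small ?odd_double ?doubleK // ltn_double.
have -> : x.*2 = (x - t).*2 + t.*2 by rewrite -doubleD subnK.
rewrite modnDr modn_small ?odd_double ?doubleK // ltn_double.
by rewrite ltn_subLR // addnn.
Qed.

(** What [quasi_graph half_op] leaves uncovered once a point at infinity, [None], is adjoined. *)
Definition skolem_rest (p q : option ('I_n * 'I_3)) : nat :=
  match p, q with
  | Some (x, i), Some (y, j) =>
      if i == j then 0
      else if j == ordS i then y == half_op x x else x == half_op y y
  | None, None => 0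
  | _, _ => 1
  end.

Lemma lo_proof (x : 'I_t) : x < n. Proof. by have := ltn_ord x; lia. Qed.
Lemma hi_proof (x : 'I_t) : x + t < n. Proof. by have := ltn_ord x; lia. Qed.
Let lo (x : 'I_t) : 'I_n := Ordinal (lo_proof x).
Let hi (x : 'I_t) : 'I_n := Ordinal (hi_proof x).

Lemma lohi (y : 'I_n) : (exists x, y = lo x /\ half_op y y = lo x)
  \/ (exists x, y = hi x /\ half_op y y = lo x).
Proof.
have := half_opxx y; case: ltnP => h E.
  by left; exists (Ordinal h); split; apply: val_inj.
have h' : y - t < t by have := ltn_ord y; lia.
by right; exists (Ordinal h'); split; apply: val_inj => //=; rewrite subnK.
Qed.

Lemma loI : injective lo.
Proof. by move=> x y /(congr1 val) /= /val_inj. Qed.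
Lemma hiI : injective hi.
Proof. by move=> x y /(congr1 val) /= /addIn/val_inj. Qed.
Lemma lo_hi x y : lo x = hi y -> False.
Proof. by move/(congr1 val) => /=; have := ltn_ord x; lia. Qed.

(** Since x and x + t both square to x, for x < t, the uncovered pairs split into the triangles
    {(x,0), (x,1), (x,2)} and {None, (x+t,i), (x,i+1)}. *)
Lemma skolem_rest_dec : dec k 0 skolem_rest.
Proof.
pose b (m : 'I_t * option 'I_3) : seq (option ('I_n * 'I_3)) := match m.2 with
  | None => [seq Some (lo m.1, j) | j <- enum 'I_3]
  | Some j => [:: None; Some (hi m.1, j); Some (lo m.1, ordS j)]
  end.
have SomeE (A : eqType) (u v : A) : (Some u == Some v) = (u == v) by [].
have bN x : (None \in b (x, None)) = false.
  by apply/negP => /mapP[].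
have bS x y i : (Some (y, i) \in b (x, None)) = (y == lo x).
  apply/mapP/eqP => [[j _ [-> _]] //|->]; by exists i; rewrite ?mem_enum.
have bSN x j : None \in b (x, Some j) by rewrite inE.
have bSS x y i j : (Some (y, i) \in b (x, Some j)) =
    ((y == hi x) && (i == j)) || ((y == lo x) && (i == ordS j)).
  by rewrite !inE /= !SomeE !xpair_eqE.
have hl x y : (hi x == lo y) = false by apply/eqP => /esym/lo_hi.
have lh x y : (lo x == hi y) = false by apply/eqP => /lo_hi.
have ll x y : (lo x == lo y) = (x == y) := inj_eq loI x y.
have hh x y : (hi x == hi y) = (x == y) := inj_eq hiI x y.
have ordS_3 (i : 'I_3) : ordS (ordS (ordS i)) = i.
  by apply: val_inj; move: i => [[|[|[|i]]] i3].
have sym1 p q : \sum_m (p \in b m) && (q \in b m) = \sum_m (q \in b m) && (p \in b m).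
  by apply: eq_bigr => m _; rewrite andbC.
have sym2 p q : skolem_rest p q = skolem_rest q p.
  case: p q => [[x i]|] [[y j]|] //=; rewrite eq_sym; case: eqP => // ij.
  have := ordS3 i j; rewrite eq_sym; case/or3P => [/eqP/esym//|/eqP->|/eqP->];
  by rewrite !eqxx ?ordS3_neq.
apply: (@dec_indexed _ _ predT k b) => [[x [j|]] _|].
- by rewrite /b /= !inE !SomeE !xpair_eqE hl.
- rewrite /b /= map_inj_uniq ?enum_uniq; last by move=> u v [].
  by rewrite size_map size_enum_ord.
move=> p q; rewrite (eq_bigr (fun m => (p \in b m) && (q \in b m) : nat)) //.
have Ncase x i : \sum_m (None \in b m) && (Some (x, i) \in b m) = 1.
  case: (lohi x) => [[z [-> _]]|[z [-> _]]].
    apply: (@sum_nat_uniq _ _ (z, Some (ordS (ordS i)))).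
      by rewrite bSN bSS ll !eqxx ordS_3 eqxx orbT.
    move=> [y [j|]]; rewrite ?bN // bSN bSS lh ll /= => /andP[/eqP-> /eqP->].
    by rewrite ordS_3.
  apply: (@sum_nat_uniq _ _ (z, Some i)); first by rewrite bSN bSS hh !eqxx.
  move=> [y [j|]]; rewrite ?bN // bSN bSS hl hh /= orbF => /andP[/eqP-> /eqP->] //.
have Scase x i y j : (x, i) != (y, j) -> (j == i) || (j == ordS i) ->
  \sum_m (Some (x, i) \in b m) && (Some (y, j) \in b m)
   = skolem_rest (Some (x, i)) (Some (y, j)).
  rewrite /skolem_rest; case: (eqVneq i j) => [<-|nij] /=.
    rewrite xpair_eqE eqxx andbT => nxy _; apply: sum_nat_none => -[z [l|]].
      rewrite !bSS; apply/negP => /andP[/orP[]/andP[/eqP xE /eqP iE] /orP[]/andP[/eqP yE /eqP jE]];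
      move: iE jE nxy; rewrite xE yE ?eqxx // => -> /eqP; by rewrite ordS3_neq.
    by rewrite !bS; apply/negP => /andP[/eqP xE /eqP yE]; rewrite xE yE eqxx in nxy.
  move=> _ /eqP ->; rewrite eqxx.
  case: (lohi x) => [[z [-> ->]]|[z [-> ->]]]; case: (eqVneq y (lo z)) => [->|ny] /=.
  - apply: (@sum_nat_uniq _ _ (z, None)); first by rewrite !bS eqxx.
    move=> [u [l|]]; last by rewrite !bS !ll => /andP[/eqP->].
    by rewrite !bSS !lh !ll /= => /andP[/andP[/eqP-> /eqP->] /andP[_]]; rewrite ordS3_neq.
  - apply: sum_nat_none => -[u [l|]].
      rewrite !bSS !lh !ll /=; apply/negP => /andP[/andP[_ /eqP->] /orP[]/andP[_]];
      by rewrite !ordS3_neq.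
    by rewrite !bS ll; apply/negP => /andP[/eqP <-]; apply/negP.
  - apply: (@sum_nat_uniq _ _ (z, Some i)); first by rewrite !bSS hh ll !eqxx orbT.
    move=> [u [l|]]; last by rewrite !bS hl.
    by rewrite !bSS hl hh !orbF => /andP[/andP[/eqP-> /eqP->]].
  - apply: sum_nat_none => -[u [l|]]; last by rewrite !bS hl.
    rewrite !bSS hl hh orbF; apply/negP => /andP[/andP[/eqP<- /eqP<-]].
    by rewrite (negPf ny) ordS3_neq !andbF.
case: p q => [[x i]|] [[y j]|] //=.
- move=> nxy; have [h|h] := boolP ((j == i) || (j == ordS i)); first exact: Scase.
  have h' : i == ordS j by move: h; have := ordS3 i j; case: (j == i); case: (j == _).
  by rewrite sym1 -[RHS]/(skolem_rest (Some (x, i)) (Some (y, j))) sym2 Scase ?h' ?orbT // eq_sym.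
- by rewrite sym1 Ncase.
Qed.

Lemma skolem : pbd k 0 (6 * t).+1.
Proof.
have -> : (6 * t).+1 = #|{: option ('I_n * 'I_3)}|.
  by rewrite card_option card_prod !card_ord; lia.
apply/dec_completeP.
pose e (p q : option ('I_n * 'I_3)) : nat := match p, q with
  | Some u, Some v => quasi_graph half_op u v | _, _ => 0 end.
have He : dec k 0 e.
  apply: (dec_mapF (f := Some)) (quasi_dec half_opC half_opI k).
  - by move=> u v [].
  - by [].
  by move=> [u|] [v|] _ //= [] h; [have := h u|have := h v]; rewrite eqxx.
apply: dec_ext (decD He skolem_rest_dec) => -[[x i]|] [[y j]|] //= nxy.
rewrite /quasi_graph /=; case: (i =P j) nxy => [->|_ _].
  by rewrite -[Some _ == _]/((x, j) == (y, j)) xpair_eqE eqxx andbT => ->.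
by case: ifP => _; case: eqP.
Qed.
End Skolem.

Lemma gdd_groups k u w n n' : gdd k n u w -> pbd k n' w -> pbd k (n + u * n') (u * w).
Proof.
move=> G P; have -> : u * w = #|{: 'I_u * 'I_w}| by rewrite card_prod !card_ord.
apply/dec_completeP.
have H : dec k (\sum_(i < u) n') (fun p q : 'I_u * 'I_w =>
    \sum_(i < u) ((p.1 == i) && (q.1 == i))).
  apply: dec_sum => i _; apply: (dec_mapF (f := pair i)) P.
  - by move=> a b [].
  - by move=> a b _; rewrite /= eqxx.
  move=> [a b] [c d] _ /= [] h.
    by case: eqP => // ai; have := h b; rewrite ai eqxx.
  by case: (c =P i) => [ci|]; [have := h d; rewrite ci eqxx | rewrite andbF].
rewrite sum_nat_const card_ord in H.
apply: dec_ext (decD G H) => -[a b] [c d] _ /=.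
case: eqP => [->|nac] /=.
  by rewrite (@sum_nat_uniq _ (fun i => (c == i) && (c == i)) c) ?eqxx // => j /andP[/eqP].
by rewrite sum_nat_none // => j; apply/negP => /andP[/eqP<- /eqP/esym].
Qed.

Lemma pbd3 k : pbd k 0 3.
Proof.
apply: dec_ext (@dec_tri _ k (enum 'I_3) (enum_uniq _) _); last by rewrite size_enum_ord.
by move=> x y _; rewrite !mem_enum.
Qed.

Lemma sts k m : m %% 6 = 1 \/ m %% 6 = 3 -> pbd k 0 m.
Proof.
move=> [] h; rewrite (divn_eq m 6) h; first by rewrite addn1 mulnC; apply: skolem.
have := gdd_groups (bose k (m %/ 6)) (pbd3 k); rewrite muln0 addn0.
by congr (pbd _ _ _); lia.
Qed.

(** * Weighting the points and filling the groups of a design *)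

Lemma blow_triangle (T : finType) k x (b : seq T) : uniq b -> size b = 3 ->
  dec k 0 (fun p q : T * 'I_x.+1 => [&& p.1 != q.1, p.1 \in b & q.1 \in b]).
Proof.
case: b => [|a [|b [|c []]]] //= u _.
have [ab ac bc] : [/\ a != b, a != c & b != c].
  by move: u; rewrite !inE negb_or -!andbA => /and4P[].
(* The Latin square i + j + l = 0 over the integers modulo [x.+1] decomposes a complete tripartite
   graph into triangles. *)
pose t (m : 'I_x.+1 * 'I_x.+1) := [:: (a, m.1); (b, m.2); (c, (- (m.1 + m.2))%R)].
apply: (@dec_indexed _ _ predT k t) => [m _|] /=.
  by rewrite !inE !xpair_eqE (negPf ab) (negPf ac) (negPf bc).
have tE w v m : ((w, v) \in t m) =
    [|| (w == a) && (v == m.1), (w == b) && (v == m.2) | (w == c) && (v == - (m.1 + m.2))%R].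
  by rewrite !inE !xpair_eqE.
have [ba ca cb] : [/\ b != a, c != a & c != b] by split; rewrite eq_sym.
have Pab s r (m : 'I_x.+1 * 'I_x.+1) : (s == m.1) && (r == m.2) = (m == (s, r)).
  by case: m => i j; rewrite xpair_eqE /= ![(_ == s)]eq_sym ![(_ == r)]eq_sym.
have Nadd (s r i : 'I_x.+1) : (r == - (s + i))%R = (i == - r - s)%R.
  apply/eqP/eqP => ->; first by rewrite opprK addrAC subrr add0r.
  by rewrite [(s + _)%R]addrC subrK opprK.
have Pac s r (m : 'I_x.+1 * 'I_x.+1) :
    (s == m.1) && (r == - (m.1 + m.2))%R = (m == (s, - r - s)%R).
  case: m => i j; rewrite xpair_eqE /= [i == s]eq_sym.
  by case: eqP => //= <-; rewrite Nadd.
have Pbc s r (m : 'I_x.+1 * 'I_x.+1) :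
    (s == m.2) && (r == - (m.1 + m.2))%R = (m == (- r - s, s)%R).
  case: m => i j; rewrite xpair_eqE /= [j == s]eq_sym andbC.
  by case: (s =P j) => [<-|_]; rewrite ?andbT ?andbF //= [(i + _)%R]addrC Nadd.
have one w : \sum_(m : 'I_x.+1 * 'I_x.+1) (m == w : nat) = 1.
  by apply: (@sum_nat_uniq _ _ w) => // m /eqP.
move=> [y s] [z r] nyz /=; case: (eqVneq y z) => [yz|nyz'] /=.
  apply: sum_nat_none => m; rewrite !tE yz; apply/negP => /andP[].
  have {nyz}nsr : s != r by move: nyz; rewrite xpair_eqE yz eqxx.
  move=> /or3P[]/andP[/eqP yE /eqP sE] /or3P[]/andP[/eqP zE /eqP rE];
  by [move: nsr; rewrite sE rE eqxx | move: ab; rewrite -yE -zE eqxx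
     |move: ac; rewrite -yE -zE eqxx|move: bc; rewrite -yE -zE eqxx].
case: (boolP ((y \in [:: a; b; c]) && (z \in [:: a; b; c]))) => [|nin]; last first.
  apply: sum_nat_none => m; apply: contra nin; rewrite !tE !inE => /andP[h1 h2].
  by apply/andP; split; [case/or3P: h1|case/or3P: h2] => /andP[-> _]; rewrite ?orbT.
rewrite !inE => /andP[/or3P[]/eqP yE /or3P[]/eqP zE]; subst y z; try by rewrite eqxx in nyz'.
- apply: etrans (one (s, r)); apply: eq_bigr => m _.
  by rewrite !tE ?eqxx ?(negPf ab) ?(negPf ac) ?(negPf bc) ?(negPf ba) ?(negPf ca) ?(negPf cb) /= ?orbF -Pab.
- apply: etrans (one (s, - r - s)%R); apply: eq_bigr => m _.
  by rewrite !tE ?eqxx ?(negPf ab) ?(negPf ac) ?(negPf bc) ?(negPf ba) ?(negPf ca) ?(negPf cb) /= ?orbF -Pac.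
- apply: etrans (one (r, s)); apply: eq_bigr => m _.
  by rewrite !tE ?eqxx ?(negPf ab) ?(negPf ac) ?(negPf bc) ?(negPf ba) ?(negPf ca) ?(negPf cb) /= ?orbF -Pab andbC.
- apply: etrans (one (- r - s, s)%R); apply: eq_bigr => m _.
  by rewrite !tE ?eqxx ?(negPf ab) ?(negPf ac) ?(negPf bc) ?(negPf ba) ?(negPf ca) ?(negPf cb) /= ?orbF -Pbc.
- apply: etrans (one (r, - s - r)%R); apply: eq_bigr => m _.
  by rewrite !tE ?eqxx ?(negPf ab) ?(negPf ac) ?(negPf bc) ?(negPf ba) ?(negPf ca) ?(negPf cb) /= ?orbF -Pac andbC.
- apply: etrans (one (- s - r, r)%R); apply: eq_bigr => m _.
  by rewrite !tE ?eqxx ?(negPf ab) ?(negPf ac) ?(negPf bc) ?(negPf ba) ?(negPf ca) ?(negPf cb) /= ?orbF -Pbc andbC.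
Qed.

Lemma dec_blow (T : finType) k x (e : T -> T -> nat) : dec k 0 e ->
  dec k 0 (fun p q : T * 'I_x.+1 => if p.1 == q.1 then 0 else e p.1 q.1).
Proof.
move=> [L [M [_ hM /size0nil L0 c]]].
have H : dec k 0 (fun p q : T * 'I_x.+1 =>
    \sum_(b <- M | b \in M) [&& p.1 != q.1, p.1 \in b & q.1 \in b]).
  apply: dec_sum0 => b /(allP hM)/andP[ub /eqP sb]; exact: blow_triangle.
apply: dec_ext H => p q _; rewrite -big_seq; case: eqP => /= [_|/eqP pq]; first by rewrite big1.
by rewrite -c // L0 /cover big_nil.
Qed.

Lemma gdd_blow k u w x : gdd k 0 u w -> gdd k 0 u (w * x.+1).
Proof.
move=> /(dec_blow x) H.
have -> : gdd k 0 u (w * x.+1) = gdd k 0 #|'I_u| #|{: 'I_w * 'I_x.+1}|.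
  by rewrite card_prod !card_ord.
apply/gddP; apply: (dec_bij (f := fun p => (p.1.1, (p.1.2, p.2)))) H.
  by exists (fun p => ((p.1, p.2.1), p.2.2)) => [[[a b] c]|[a [b c]]].
by move=> [[a b] c] [[a' b'] c'] _ /=; rewrite xpair_eqE; case: eqP => //=; case: ifP.
Qed.

Lemma pbd_blow k v x : pbd k 0 v -> gdd k 0 v x.+1.
Proof.
by move=> /(dec_blow x); apply: dec_ext => p q _; case: eqP.
Qed.

Lemma gdd_fill k n n' u s x :
  gdd k n u (s * x) -> gdd k n' s x -> gdd k (n + u * n') (u * s) x.
Proof.
have -> : gdd k n u (s * x) = gdd k n #|'I_u| #|{: 'I_s * 'I_x}|.
  by rewrite card_prod !card_ord.
move=> /gddP G P.
have -> : gdd k (n + u * n') (u * s) x = gdd k (n + u * n') #|{: 'I_u * 'I_s}| #|'I_x|.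
  by rewrite card_prod !card_ord.
apply/gddP.
have G' : dec k n (fun p q : ('I_u * 'I_s) * 'I_x => (p.1.1 != q.1.1) : nat).
  apply: (dec_bij (f := fun p => ((p.1, p.2.1), p.2.2))) G => //.
  by exists (fun p => (p.1.1, (p.1.2, p.2))) => [[a [b c]]|[[a b] c]].
have H : dec k (\sum_(i < u) n') (fun p q : ('I_u * 'I_s) * 'I_x =>
    \sum_(i < u) [&& p.1.1 == i, q.1.1 == i & p.1.2 != q.1.2]).
  apply: dec_sum => i _; apply: (dec_mapF (f := fun p => ((i, p.1), p.2))) P.
  - by move=> [a b] [c d] [-> ->].
  - by move=> a b _; rewrite /= eqxx.
  move=> [[z a] b] [[z' c] d] _ /= [] h.
    by case: eqP => // ai; have := h (a, b); rewrite ai eqxx.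
  by case: (z' =P i) => [ci|]; [have := h (c, d); rewrite ci eqxx | rewrite andbF].
rewrite sum_nat_const card_ord in H.
apply: dec_ext (decD G' H) => -[[z a] b] [[z' c] d] _ /=; rewrite xpair_eqE.
case: (eqVneq z z') => [->|nac] /=; last first.
  by rewrite sum_nat_none // => j; apply/negP => /and3P[/eqP<- /eqP E _]; rewrite E eqxx in nac.
rewrite add0n; case: (a != c); last by rewrite sum_nat_none // => j; rewrite !andbF.
by rewrite (@sum_nat_uniq _ _ z') ?eqxx // => j /andP[/eqP].
Qed.

(** The affine plane of order 3 minus a point; the four lines through that point become the
    groups. *)
Lemma gdd42 k : gdd k 0 4 2.
Proof.
pose pt (m : nat * nat) : 'I_4 * 'I_2 := (inZp m.1, inZp m.2).
pose t := [:: [:: (0, 0); (1, 0); (2, 0)]; [:: (0, 0); (1, 1); (3, 0)];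
  [:: (0, 0); (2, 1); (3, 1)]; [:: (0, 1); (1, 0); (3, 1)];
  [:: (0, 1); (1, 1); (2, 1)]; [:: (0, 1); (2, 0); (3, 0)];
  [:: (1, 0); (2, 1); (3, 0)]; [:: (1, 1); (2, 0); (3, 1)]].
exists [::], (map (map pt) t); split=> //.
move=> x y; rewrite /cover big_nil add0n unlock.
move: x y => [[[|[|[|[|x]]]] hx] [[|[|s]] hs]] // [[[|[|[|[|y]]]] hy] [[|[|r]] hr]] //;
by vm_compute.
Qed.

Lemma gdd_odd6 k t : gdd k 0 t.*2.+1 6.
Proof. by have := gdd_blow 1 (bose k t). Qed.

(* [6^4] groups fill the groups of [24^n']. *)
Lemma gdd_four_odd6 k t : gdd k 0 (t.*2.+1 * 4) 6.
Proof.
have := @gdd_fill k 0 0 t.*2.+1 4 6 (gdd_blow 7 (bose k t)) (gdd_blow 2 (gdd42 k)).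
by rewrite muln0.
Qed.

(** * Transversal designs *)

(* [2^k] minus a transversal [K_k]. *)
Definition near_graph k (p q : 'I_k * bool) : nat :=
  (p.1 != q.1) && ~~ (p.2 && q.2).

(** The triples {(a,false), (b,false), (ab,true)} with a < b and an idempotent operation:
    idempotency is what makes them miss exactly the pairs (x,false), (x,true). *)
Lemma near_factor k t : dec k 0 (@near_graph t.*2.+1).
Proof.
have [op [opC opI opx]] := mid_op t.
have opK x y : op x (invF (@opI x) y) = y by rewrite f_invF.
pose b (m : 'I_t.*2.+1 * 'I_t.*2.+1) := [:: (m.1, false); (m.2, false); (op m.1 m.2, true)].
pose P (m : 'I_t.*2.+1 * 'I_t.*2.+1) := m.1 < m.2.
have bF x m : ((x, false) \in b m) = (x == m.1) || (x == m.2).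
  by rewrite !inE !xpair_eqE !eqxx !andbT !andbF orbF.
have bT x m : ((x, true) \in b m) = (x == op m.1 m.2).
  by rewrite !inE !xpair_eqE !eqxx !andbT !andbF.
pose w (x y : 'I_t.*2.+1) := if x < y then (x, y) else (y, x).
have wP (x y : 'I_t.*2.+1) : x != y ->
    [/\ P (w x y), x \in [:: (w x y).1; (w x y).2], y \in [:: (w x y).1; (w x y).2]
      & op (w x y).1 (w x y).2 = op x y].
  move=> xy; have nV : (val x == val y) = false by apply: negbTE.
  rewrite /w /P; case: (ltngtP x y) => /= [h|h|/eqP]; last by rewrite nV.
    by rewrite !inE !eqxx orbT.
  by rewrite !inE !eqxx orbT; split.
have wu (x y : 'I_t.*2.+1) m : P m -> x != y -> (x == m.1) || (x == m.2) ->
    (y == m.1) || (y == m.2) -> m = w x y.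
  case: m => a c; rewrite /P /w /= => ac xy /orP[]/eqP xE /orP[]/eqP yE; subst x y;
    try by rewrite eqxx in xy.
    by rewrite ac.
  by rewrite ltnNge ltnW.
have FT x z : \sum_m [&& P m, (x, false) \in b m & (z, true) \in b m] = (x != z).
  case: eqP => [->|/eqP xz] /=.
    apply: sum_nat_none => -[a c]; rewrite bF bT /P /=; apply/negP.
    case/and3P => ac /orP[]/eqP -> /eqP E.
      by rewrite -{1}(opx a) in E; move: E ac => /opI ->; rewrite ltnn.
    by rewrite -{1}(opx c) (opC a) in E; move: E ac => /opI ->; rewrite ltnn.
  have xy : x != invF (@opI x) z.
    by apply: contra xz => /eqP E; have := opK x z; rewrite -E opx => ->.
  have [h1 h2 h3 h4] := wP _ _ xy.
  apply: (@sum_nat_uniq _ _ (w x (invF (@opI x) z))).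
    by rewrite h1 bF bT h4 opK eqxx; move: h2; rewrite !inE => ->.
  move=> m /and3P[mP]; rewrite bF bT => xm /eqP zE; apply: wu => //.
  have : op x (invF (@opI x) z) = op m.1 m.2 by rewrite opK.
  move: (invF _ z) => y'; case/orP: xm => /eqP ->; last rewrite [RHS]opC.
    by move/opI ->; rewrite eqxx orbT.
  by move/opI ->; rewrite eqxx.
apply: (@dec_indexed _ _ P k b) => [m mP|[x u] [y v] nxy].
  rewrite /= !inE !xpair_eqE !andbF !orbF !andbT.
  by apply/negP => /eqP E; move: mP; rewrite /P E ltnn.
case: u v nxy => [] [] nxy; rewrite /near_graph /= ?andbF ?andbT.
- apply: sum_nat_none => m; apply/negP; rewrite !bT => /and3P[_ /eqP xE /eqP yE].
  by rewrite xE yE eqxx in nxy.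
- by rewrite eq_sym -FT; apply: eq_bigr => m _; rewrite [(_ \in _) && _]andbC.
- exact: FT.
have xy : x != y by move: nxy; rewrite xpair_eqE eqxx andbT.
rewrite xy; have [h1 h2 h3 _] := wP _ _ xy.
apply: (@sum_nat_uniq _ _ (w x y)).
  by rewrite h1 !bF; move: h2 h3; rewrite !inE => -> ->.
by move=> m /and3P[mP]; rewrite !bF; apply: wu.
Qed.

Section Lines.
Variables (K q : nat).
Let Q := q.+2.
Hypothesis cop : forall m, 0 < m < K -> coprime Q m.

(** Invertible differences of group indices are all that a field would provide. Asking only that Q
    be prime to 1, ..., K - 1 admits both powers of 7 and numbers 1 + N! v. *)
Lemma diff_unit (i j : 'I_K) : i != j ->
  ((j%:R - i%:R : 'I_Q) \is a GRing.unit)%R.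
Proof.
wlog ij : i j / i < j.
  move=> W ij; case: (ltngtP i j) => [h|h|/val_inj h]; first exact: W.
    by rewrite -unitrN opprB W // eq_sym.
  by rewrite h eqxx in ij.
move=> _; rewrite -natrB ?(ltnW ij) // -[_ \is a _]/((j - i)%:R \is a (@GRing.unit 'Z_Q)).
by rewrite unitZpE // cop // subn_gt0 ij (leq_ltn_trans (leq_subr _ _)).
Qed.

(** A line is a pair (intercept, slope), and it meets the group [i] in the single point intercept +
    i * slope. *)
Definition on_line (i : 'I_K) (x : 'I_Q) (m : 'I_Q * 'I_Q) :=
  (x == m.1 + i%:R * m.2)%R.

Lemma line_sum (i j : 'I_K) x y : i != j ->
  \sum_m (on_line i x m && on_line j y m) = 1.
Proof.
move=> /diff_unit u; pose c := ((j%:R - i%:R)^-1 * (y - x) : 'I_Q)%R.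
apply: (@sum_nat_uniq _ _ (x - i%:R * c, c)%R); rewrite /on_line /=.
  rewrite subrK eqxx /= -addrA [(- _ + _)%R]addrC -mulrBl /c mulrA divrr // mul1r.
  by rewrite addrC subrK.
move=> [a b] /= /andP[/eqP xE /eqP yE]; rewrite /c xE yE.
have -> : (a + j%:R * b - (a + i%:R * b) = (j%:R - i%:R) * b)%R.
  by rewrite opprD addrACA subrr add0r mulrBl.
by rewrite mulKr // addrK.
Qed.

(** Each point lies on one line of each slope, so the slopes behave like one more group. *)
Lemma star_sum (i : 'I_K) x (c : 'I_Q) :
  \sum_m (on_line i x m && (m.2 == c)) = 1.
Proof.
apply: (@sum_nat_uniq _ _ (x - i%:R * c, c)%R).
  by rewrite /on_line /= subrK !eqxx.
by move=> [a b] /andP[/= /eqP-> /eqP->]; rewrite addrK.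
Qed.
End Lines.

Section Transversal.
Variables (K q : nat).
Local Notation Q := (q.+2).
Hypothesis cop : forall m, 0 < m < K -> coprime Q m.

Lemma transversal_design : gdd K (Q * Q) K Q.
Proof.
pose l (m : 'I_Q * 'I_Q) := [seq (i, (m.1 + i%:R * m.2)%R) | i : 'I_K <- enum 'I_K].
have lE i x m : ((i, x) \in l m) = on_line i x m.
  by apply/mapP/eqP => [[j _ [-> ->]]|->] //; exists i; rewrite ?mem_enum.
have H : dec K (\sum_(m : 'I_Q * 'I_Q) 1) (fun p r => \sum_m ((p \in l m) && (r \in l m))).
  apply: dec_sum => m _; apply: dec_line.
    by rewrite map_inj_uniq ?enum_uniq // => i j [].
  by rewrite size_map size_enum_ord.
rewrite sum1_card card_prod !card_ord in H.
apply: dec_ext H => -[i x] [j y] nxy /=; under eq_bigr do rewrite !lE.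
case: (eqVneq i j) nxy => [<-|ij _]; last exact: line_sum.
rewrite xpair_eqE eqxx /= => nxy; apply: sum_nat_none => m.
by apply: contra nxy => /andP[/eqP-> /eqP->].
Qed.

Lemma sum_slopes e : e <= Q -> \sum_(m : 'I_Q * 'I_Q | e <= m.2) 1 = Q * (Q - e).
Proof.
move=> eQ; rewrite -(pair_big_dep predT (fun _ (c : 'I_Q) => e <= c) (fun _ _ => 1)) /=.
rewrite (eq_bigr (fun _ => Q - e)) => [|i _]; first by rewrite sum_nat_const card_ord.
transitivity (\sum_(e <= c < Q) 1); last by rewrite sum_nat_const_nat muln1.
by rewrite big_geq_mkord; apply: eq_bigl.
Qed.
End Transversal.

Section Prolongation.
Variables (t q e : nat).
Local Notation K := (t.*2.+1).
Local Notation Q := (q.+2).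
Hypothesis cop : forall m, 0 < m < K -> coprime Q m.
Hypothesis eQ : e.+1 <= Q.
Local Notation T := ('I_K * ('I_Q + 'I_e.+1))%type.

(** The new point [inr c] of every group is put on all lines of slope [c]. *)
Let at_line (m : 'I_Q * 'I_Q) (p : T) : bool :=
  match p.2 with inl x => on_line p.1 x m | inr c => m.2 == c :> nat end.
Let isr (p : T) : bool := if p.2 is inr _ then true else false.

Lemma prolong_line m : dec K 1
  (fun p r : T => [&& ~~ isr p, at_line m p, ~~ isr r & at_line m r]).
Proof.
pose l := [seq (i, inl (m.1 + i%:R * m.2)%R) : T | i : 'I_K <- enum 'I_K].
have lE p : (p \in l) = ~~ isr p && at_line m p.
  case: p => i [x|c]; rewrite /isr /at_line /=.
    by apply/mapP/eqP => [[j _ [-> ->]]|->] //; exists i; rewrite ?mem_enum.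
  by apply/mapP => -[].
apply: (dec_ext _ (@dec_line T K l _ _)) => [p r _||].
- by rewrite !lE -andbA.
- by rewrite map_inj_uniq ?enum_uniq // => i j [].
- by rewrite size_map size_enum_ord.
Qed.

(** A line and the K new points of its slope form a copy of [near_graph]: the line is the [false]
    level, the new points are the [true] level. *)
Lemma prolong_near k (m : 'I_Q * 'I_Q) : m.2 < e.+1 -> dec k 0
  (fun p r : T => [&& at_line m p, at_line m r, p.1 != r.1 & ~~ (isr p && isr r)]).
Proof.
move=> me; pose f (p : 'I_K * bool) : T :=
  (p.1, if p.2 then inr (Ordinal me) else inl (m.1 + p.1%:R * m.2)%R).
have atf p : at_line m (f p) by case: p => i [] /=; apply/eqP.
have isf p : isr (f p) = p.2 by case: p => i [].
have atP p : at_line m p -> exists a, f a = p.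
  case: p => i [x|c] /= /eqP E; first by exists (i, false); rewrite /f /= -E.
  by exists (i, true); congr (_, inr _); apply: val_inj.
apply: (dec_mapF (f := f)) (near_factor k t).
- by move=> [i []] [j []] [] // ->.
- by move=> a b _; rewrite !atf !isf.
- move=> x y _ [] h; case: (boolP (at_line m x)) => //= /atP[a xa];
  case: (boolP (at_line m y)) => //= /atP[b yb].
    by have := h a; rewrite xa eqxx.
  by have := h b; rewrite yb eqxx.
Qed.

(* Each of the first [e.+1] parallel classes of lines is traded for one new point in
   every group. *)
Lemma prolongation : pbd K 0 K -> gdd K (Q * (Q - e.+1)) K (Q + e.+1).
Proof.
move=> /(pbd_blow e) E.
have -> : gdd K (Q * (Q - e.+1)) K (Q + e.+1) =
    gdd K (Q * (Q - e.+1)) #|'I_K| #|{: 'I_Q + 'I_e.+1}|.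
  by rewrite card_sum !card_ord.
apply/gddP; rewrite -(sum_slopes eQ).
have HL : dec K (\sum_(m : 'I_Q * 'I_Q | e.+1 <= m.2) 1) (fun p r : T =>
    \sum_(m : 'I_Q * 'I_Q | e.+1 <= m.2) [&& ~~ isr p, at_line m p, ~~ isr r & at_line m r]).
  by apply: dec_sum => m _; apply: prolong_line.
have HN : dec K 0 (fun p r : T => \sum_(m : 'I_Q * 'I_Q | m.2 < e.+1)
    [&& at_line m p, at_line m r, p.1 != r.1 & ~~ (isr p && isr r)]).
  by apply: dec_sum0 => m me; apply: prolong_near.
have HE : dec K 0 (fun p r : T => [&& isr p, isr r & p.1 != r.1] : nat).
  apply: (dec_mapF (f := fun p : 'I_K * 'I_e.+1 => (p.1, inr p.2) : T)) E.
  - by move=> [a b] [c d] [-> ->].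
  - by [].
  - move=> [i [x|c]] [j [y|d]] _ //= [] h; first by have := h (i, c); rewrite eqxx.
    by have := h (j, d); rewrite eqxx.
have := decD HL (decD HN HE); rewrite !addn0; apply: dec_ext.
have star (i : 'I_K) x (c : 'I_e.+1) :
    \sum_(m : 'I_Q * 'I_Q | m.2 < e.+1) (on_line i x m && (m.2 == c :> nat)) = 1.
  rewrite big_mkcond -(star_sum i x (widen_ord eQ c)); apply: eq_bigr => m _.
  rewrite -[m.2 == widen_ord _ _]val_eqE /=; case: ifP => // mc.
  case: eqP => [mE|_]; last by rewrite andbF.
  by rewrite mE ltn_ord in mc.
move=> [i [x|c]] [j [y|d]] nxy; rewrite /isr /at_line /= ?andbT.
- rewrite !addn0; case: (eqVneq i j) nxy => [<-|ij _] /=.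
    rewrite xpair_eqE eqxx /= => nxy.
    rewrite [X in _ + X]big1 => [|m _]; last by rewrite !andbF.
    rewrite big1 // => m _; case: (boolP (on_line i x m)) => //= /eqP xE.
    by case: (boolP (on_line i y m)) => //= /eqP yE; rewrite xE yE eqxx in nxy.
  rewrite -(line_sum cop x y ij) [RHS](bigID (fun m : 'I_Q * 'I_Q => e.+1 <= m.2)) /=.
  by congr (_ + _); apply: eq_big => m; rewrite ?andbT // -ltnNge.
- rewrite !addn0 big1 ?add0n => [|m _]; last by rewrite andbF.
  case: (i != j); last by rewrite big1 // => m _; rewrite !andbF.
  by rewrite -[RHS](star i x d); apply: eq_bigr => m _; rewrite !andbT.
- rewrite !addn0 big1 // add0n.
  case: (i != j); last by rewrite big1 // => m _; rewrite !andbF.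
  by rewrite -[RHS](star j y c); apply: eq_bigr => m _; rewrite !andbT andbC.
by rewrite !big1 // => m _; rewrite !andbF.
Qed.
End Prolongation.

(** * Designs on 7^d points with all blocks of size 7 *)

Lemma pbd_mul K q n : (forall m, 0 < m < K -> coprime q.+2 m) -> pbd K n q.+2 ->
  pbd K (q.+2 * q.+2 + K * n) (K * q.+2).
Proof. by move=> cop; apply: gdd_groups; apply: transversal_design. Qed.

(** As 7^d is prime to 1, ..., 6, a transversal design with seven groups of size 7^d multiplies the
    number of points by 7. A 7-set has 42 ordered pairs, so the equation says that no pair is left
    to the triples. *)
Lemma pbd_exp7 d : exists n, pbd 7 n (7 ^ d.+1) /\ n * 42 = 7 ^ d.+1 * (7 ^ d.+1).-1.
Proof.
elim: d => [|d [n [P E]]].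
  exists 1; split => //.
  apply: dec_ext (@dec_line _ 7 (enum 'I_7) (enum_uniq _) _); last by rewrite size_enum_ord.
  by move=> x y _; rewrite !mem_enum.
have d0 : 0 < 7 ^ d by rewrite expn_gt0.
have : 7 ^ d.+1 > 2 by rewrite expnS; lia.
have cop m : 0 < m < 7 -> coprime (7 ^ d.+1) m.
  by move=> h; rewrite coprimeXl // prime_coprime // gtnNdvd; case/andP: h.
rewrite [7 ^ d.+2]expnS; move: E P cop; case: (7 ^ d.+1) => [|[|q]] // E P cop _.
exists (q.+2 * q.+2 + 7 * n); split; first exact: pbd_mul.
by move: E; nia.
Qed.

(** * Truncated designs with weights *)

Definition isr (A B : Type) (p : A + B) : bool := if p is inr _ then true else false.

(** A hole of one point contains no pair; a hole of three points is obtained by removing one triple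
    of the system and renaming the points. *)
Lemma pbd_hole k c (V : finType) : c = 1 \/ c = 3 -> pbd k 0 (#|V| + c) ->
  dec k 0 (fun p q : V + 'I_c => ~~ (isr p && isr q) : nat).
Proof.
have -> : #|V| + c = #|{: V + 'I_c}| by rewrite card_sum card_ord.
move=> [] c13 /dec_completeP P.
  subst c; apply: dec_ext P => p q pq.
  by case: p q pq => [x|i] [y|j] //=; rewrite -[inr _ == _]/(i == j) !ord1.
subst c; case: P => L [M [_ hM /size0nil L0 cM]].
have [b bM] : exists b, b \in M.
  have := cM (inr ord0) (inr ord_max) isT; rewrite L0 /cover big_nil add0n.
  by case: (M) => [|b M' _]; [rewrite big_nil | exists b; rewrite inE eqxx].
have /andP[ub /eqP sb] := allP hM b bM.
(* The points are listed with the removed triple at the end, to be matched with [inl] first and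
   [inr] last. *)
pose s := [seq x <- enum {: V + 'I_3} | x \notin b] ++ b.
have us : uniq s.
  rewrite cat_uniq ub filter_uniq ?enum_uniq // andbT /=.
  by apply/hasPn => x xb; rewrite mem_filter xb.
have mems x : x \in s by rewrite mem_cat mem_filter mem_enum; case: (x \in b).
have ss : size s = #|V| + 3.
  have := eq_cardT mems; rewrite (card_uniqP us) => ->.
  by rewrite -cardT card_sum card_ord.
pose x0 : V + 'I_3 := inr ord0.
pose g (p : V + 'I_3) := nth x0 s (match p with
  | inl v => enum_rank v | inr j => #|V| + j end).
have idx (p : V + 'I_3) :
    match p with inl v => nat_of_ord (enum_rank v) | inr j => #|V| + j end < size s.
  rewrite ss; case: p => [v|j]; last by rewrite ltn_add2l.
  by apply: leq_trans (ltn_ord _) (leq_addr _ _).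
have gI : injective g.
  move=> p p' /eqP; rewrite nth_uniq // => /eqP.
  case: p p' => [v|j] [v'|j'].
  - by move/val_inj/enum_rank_inj->.
  - by move=> E; have := ltn_ord (enum_rank v); rewrite E ltnNge leq_addr.
  - by move=> E; have := ltn_ord (enum_rank v'); rewrite -E ltnNge leq_addr.
  - by move/addnI/val_inj->.
have gb p : (g p \in b) = isr p.
  have fs : size [seq x <- enum {: V + 'I_3} | x \notin b] = #|V|.
    by move: ss; rewrite size_cat sb => /addIn.
  rewrite /g nth_cat fs; case: p => [v|j] /=.
    rewrite ltn_ord; apply/negP => vb.
    have := mem_nth x0 (_ : enum_rank v < size [seq x <- enum {: V + 'I_3} | x \notin b]).
    by rewrite fs ltn_ord => /(_ isT); rewrite mem_filter vb.
  by rewrite ltnNge leq_addr /= addKn mem_nth // sb.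
have [h gK hK] := injF_bij gI.
have D : dec k 0 (fun p q : V + 'I_3 => ~~ ((p \in b) && (q \in b)) : nat).
  exists [::], (rem b M); split=> //.
    by apply/allP => x /mem_rem; apply: (allP hM).
  move=> p q pq; have := cM p q pq; rewrite L0 /cover !big_nil !add0n.
  rewrite (perm_big _ (perm_to_rem bM)) big_cons /=.
  move: (\sum_(_ <- rem b M) _) => S. case: ((p \in b) && (q \in b)) => /=; lia.
apply: (dec_bij (f := h)) D; first by exists g.
by move=> p q _; rewrite -!gb !hK.
Qed.

Section TruncatedDesign.
Variables (k n N q r c : nat).
Local Notation Q := (q.+2).
Hypothesis cop : forall m, 0 < m < N -> coprime Q m.
Hypothesis rQ : r <= Q.
Hypothesis c13 : c = 1 \/ c = 3.
Hypothesis G1 : gdd k n N 6.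
Hypothesis G2 : gdd k 0 N.+1 6.
Hypothesis P1 : pbd k 0 (6 * Q + c).
Hypothesis P2 : pbd k 0 (6 * r + c).
Hypothesis Pc : pbd k 0 c.

Local Notation U := ('I_N * 'I_Q + 'I_r)%type.
Local Notation T := (U * 'I_6 + 'I_c)%type.

(** The points [inr s] are the points at infinity of the slopes s < r: lines of these slopes have N
    + 1 points, the others have N. *)
Let on (m : 'I_Q * 'I_Q) (u : U) : bool :=
  match u with inl p => on_line p.1 p.2 m | inr s => m.2 == s :> nat end.
Let gi (u : U) : option 'I_N := if u is inl p then Some p.1 else None.

Let line_graph m (p p' : T) : nat :=
  if p is inl u then if p' is inl u' then [&& on m u.1, on m u'.1 & u.1 != u'.1]
  else false else false.
(** A weighted group together with the [c] points common to all groups. Pairs of common points are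
    excluded, since they would be covered once per group; [Pc] covers them a single time. *)
Let group_graph (g : option 'I_N) (p p' : T) : nat :=
  [&& (if p is inl u then gi u.1 == g else true),
      (if p' is inl u then gi u.1 == g else true) & ~~ (isr p && isr p')].

Lemma on_sum u u' : u != u' -> \sum_m (on m u && on m u') = (gi u != gi u').
Proof.
have aux (i : 'I_N) (x : 'I_Q) (s : 'I_r) : \sum_m (on_line i x m && (m.2 == s :> nat)) = 1.
  by rewrite -(star_sum i x (widen_ord rQ s)).
case: u u' => [[i x]|s] [[j y]|s'] /=.
- case: (eqVneq i j) => [<-|ij _]; last first.
    by rewrite (line_sum cop) //; case: eqP => // -[] /eqP; rewrite (negPf ij).
  rewrite eqxx => nxy; apply: sum_nat_none => m; apply: contra nxy.
  by case/andP => /eqP-> /eqP->.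
- by move=> _; apply: aux.
- by move=> _; under eq_bigr do rewrite andbC; apply: aux.
- move=> nss; apply: sum_nat_none => m; apply: contra nss => /andP[/eqP E /eqP E'].
  by rewrite -(val_inj (etrans (esym E) E')).
Qed.

Lemma line_graph_dec (m : 'I_Q * 'I_Q) : dec k (if r <= m.2 then n else 0) (line_graph m).
Proof.
case: leqP => rm.
  pose f (p : 'I_N * 'I_6) : T := inl (inl (p.1, m.1 + p.1%:R * m.2)%R, p.2).
  have fP u a : on m u -> exists p, f p = inl (u, a).
    case: u => [[i x]|s] /= /eqP E; first by exists (i, a); rewrite /f /= -E.
    by move: rm; rewrite E leqNgt ltn_ord.
  apply: (dec_mapF (f := f)) G1.
  - by move=> [i a] [j b] [-> _ ->].
  - move=> [i a] [j b] _; rewrite /line_graph /f /= /on_line /= !eqxx /=.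
    rewrite -[inl _ == _]/((i, _) == (j, _)) xpair_eqE.
    by case: eqP => //= ->; rewrite eqxx.
  - move=> [[u a]|s] [[v b]|s'] _ //= [] h.
      by case: (boolP (on m u)) => //= /(fP _ a)[p E]; have := h p; rewrite E eqxx.
    case: (boolP (on m v)) => //=; rewrite ?andbF // => /(fP _ b)[p E].
    by have := h p; rewrite E eqxx.
pose f (p : option 'I_N * 'I_6) : T := inl (match p.1 with
  | Some i => inl (i, m.1 + i%:R * m.2)%R | None => inr (Ordinal rm) end, p.2).
have fP u a : on m u -> exists p, f p = inl (u, a).
  case: u => [[i x]|s] /= /eqP E; first by exists (Some i, a); rewrite /f /= -E.
  by exists (None, a); congr (inl (inr _, _)); apply: val_inj.
have G2' : gdd k 0 #|{: option 'I_N}| #|'I_6| by rewrite card_option !card_ord.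
move/gddP: G2'; apply: (dec_mapF (f := f)).
- by move=> [[i|] a] [[j|] b] //; rewrite /f /= => -[] // -> // _ ->.
- move=> [[i|] a] [[j|] b] _; rewrite /line_graph /f /= /on_line /= ?eqxx //=.
  rewrite -[inl _ == _]/((i, _) == (j, _)) xpair_eqE -[Some _ == _]/(i == j).
  by case: eqP => //= ->; rewrite eqxx.
- move=> [[u a]|s] [[v b]|s'] _ //= [] h.
    by case: (boolP (on m u)) => //= /(fP _ a)[p E]; have := h p; rewrite E eqxx.
  case: (boolP (on m v)) => //=; rewrite ?andbF // => /(fP _ b)[p E].
  by have := h p; rewrite E eqxx.
Qed.

Lemma group_graph_dec g : dec k 0 (group_graph g).
Proof.
have gen (V : finType) (f : V -> U) : injective f ->
    (forall u, gi u == g -> exists v, f v = u) -> (forall v, gi (f v) = g) ->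
    pbd k 0 (6 * #|V| + c) -> dec k 0 (group_graph g).
  move=> fI fS fg.
  have -> : 6 * #|V| = #|{: V * 'I_6}| by rewrite card_prod card_ord mulnC.
  move/(pbd_hole c13).
  pose F (p : V * 'I_6 + 'I_c) : T := match p with
    inl va => inl (f va.1, va.2) | inr s => inr s end.
  have FS (p : T) : (if p is inl u then gi u.1 == g else true) -> exists x, F x = p.
    case: p => [[u a] /= /fS[v vu]|s _]; last by exists (inr s).
    by exists (inl (v, a)); rewrite /F /= vu.
  have FN (p : T) : (forall x, F x != p) ->
      (if p is inl u then gi u.1 == g else true) = false.
    by move=> h; apply/negP => /FS[x xp]; have := h x; rewrite xp eqxx.
  apply: (dec_mapF (f := F)).
  - by move=> [[v a]|s] [[v' a']|s'] //= [] => [/fI -> ->|->].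
  - by move=> [[v a]|s] [[v' a']|s'] _ //=; rewrite /group_graph /= ?fg ?eqxx.
  - by move=> p p' _ [] /FN h; rewrite /group_graph h ?andbF.
case: g gen => [i|] gen.
  apply: (gen 'I_Q (fun x => inl (i, x))); rewrite ?card_ord //.
  - by move=> x y [].
  - by case=> [[j x]|s] //= /eqP[<-]; exists x.
apply: (gen 'I_r (fun s => inr s)); rewrite ?card_ord //.
- by move=> x y [].
- by case=> [[j x]|s] //= _; exists s.
Qed.

(** Only the Q(Q - r) lines with N points contribute blocks of size k, [n] each; longer lines,
    groups and common points are filled with triples. *)
Lemma truncated_design : pbd k (Q * (Q - r) * n) (6 * (N * Q + r) + c).
Proof.
have -> : 6 * (N * Q + r) + c = #|{: T}|.
  by rewrite card_sum card_prod card_sum card_prod !card_ord mulnC.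
apply/dec_completeP.
have HL := dec_sum (index_enum _) (fun (m : 'I_Q * 'I_Q) (_ : predT m) => line_graph_dec m).
have HG := dec_sum0 (index_enum _) (fun g (_ : predT g) => group_graph_dec g).
have HF : dec k 0 (fun p q : T => isr p && isr q : nat).
  apply: (dec_mapF (f := inr)) Pc => //; first by move=> x y [].
  by move=> [u|s] [v|s'] _ //= [] h; [have := h s|have := h s']; rewrite eqxx.
have := decD HL (decD HG HF); rewrite !addn0 -big_mkcond /= sum_nat_const.
rewrite -sum1_card (eq_bigl (fun m : 'I_Q * 'I_Q => r <= m.2)) // sum_slopes //.
apply: dec_ext => p p' pp'; rewrite /line_graph /group_graph.
case: p p' pp' => [[u a]|s] [[v b]|s'] pp' /=.
- rewrite addn0; have := @on_sum u v; case: (eqVneq u v) => [<- _|uv /(_ isT) Huv].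
    rewrite big1 => [|m _]; last by rewrite !andbF.
    rewrite (@sum_nat_uniq _ _ (gi u)) ?eqxx // => g.
    by rewrite andbT => /andP[/eqP].
  under eq_bigr do rewrite andbT; rewrite Huv.
  case: (eqVneq (gi u) (gi v)) => [<-|guv] /=.
    rewrite add0n (@sum_nat_uniq _ _ (gi u)) ?eqxx // => g.
    by rewrite andbT => /andP[/eqP].
  rewrite big1 // => g _; case: eqP => //= <-.
  by rewrite eq_sym (negPf guv).
- rewrite big1 // add0n addn0 (@sum_nat_uniq _ _ (gi u)) ?eqxx // => g.
  by rewrite !andbT => /eqP.
- rewrite big1 // add0n addn0 (@sum_nat_uniq _ _ (gi v)) ?eqxx // => g.
  by rewrite !andbT => /eqP.
- by rewrite !big1 // => i _; rewrite !andbF.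
Qed.
End TruncatedDesign.

(** * Choice of the parameters *)

Lemma coprime_fact N v m : 0 < m < N -> coprime (1 + N`! * v) m.
Proof.
move=> /andP[m0 mN]; rewrite addnC coprime_sym /coprime.
have /dvdnP[z ->] : m %| N`! by apply: dvdn_fact; rewrite m0 ltnW.
by rewrite -mulnA mulnCA mulnC gcdnMDl gcdn1.
Qed.

Definition adm (m : nat) : Prop := m %% 6 = 1 \/ m %% 6 = 3.

Lemma odd_doubleS s : odd s -> s = s./2.*2.+1.
Proof. by move=> os; rewrite -{1}[s]odd_double_half os. Qed.

Lemma prolongation_odd K Q E : odd K -> 0 < E <= Q -> 1 < Q ->
  (forall m, 0 < m < K -> coprime Q m) -> pbd K 0 K ->
  gdd K (Q * (Q - E)) K (Q + E).
Proof.
move=> /odd_doubleS->; case: E => // e; case: Q => [|[|q]] //= eQ _ cop P.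
exact: prolongation.
Qed.

(* The choice of [x] and [E] makes [N = k * s] with [s] odd and [N = 3] modulo 8, so
   that the triple systems [6^s] and [6^(N + 1)] are available. *)
Lemma gdd_mostly_k k u : adm k -> 2 < k ->
  let x := 1 + k`! * (48 * u) in let E := 18 * k - 1 in E <= x ->
  exists N, [/\ 6 * N = k * (x + E), gdd k (x * (x - E)) N 6 & gdd k 0 N.+1 6].
Proof.
move=> ak k3 x E Ex; pose s := 8 * (k`! * u) + 3 * k.
have ok : odd k by case: ak => h; rewrite (divn_eq k 6) h; lia.
have kE := odd_doubleS ok.
have ws : x + E = s * 6 by rewrite /x /E /s; lia.
have os : odd s by rewrite /s oddD !oddM /= ok.
exists (k * s); split; first by rewrite ws; lia.
  have := @prolongation_odd k x E ok _ _ _ (sts k ak).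
  rewrite Ex ws andbT => /(_ _ _ (fun m => @coprime_fact k (48 * u) m)) F.
  have {}F := @gdd_fill k _ 0 k s 6 (F _ _); rewrite muln0 addn0 in F; apply: F.
  - by rewrite /E; lia.
  - by rewrite /E in Ex; lia.
  - by rewrite (odd_doubleS os); apply: gdd_odd6.
(* With k = 2t + 1 one has 3k^2 + 1 = 12t(t + 1) + 4, so [z] is a quarter of N + 1; it is odd
   because t(t + 1) is even. *)
pose t := k./2; pose z := 2 * k * (k`! * u) + 3 * (t * t.+1) + 1.
have zE : (k * s).+1 = z * 4 by rewrite /s /z kE -/t; nia.
have oz : odd z by rewrite /z !oddD !oddM /=; case: (odd t).
by rewrite zE (odd_doubleS oz); apply: gdd_four_odd6.
Qed.

(** With h = E/x, the ratio x(x - E)/(x + E)^2 is at least 1 - 3h, and the hypothesis gives 3h <=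
    1/(2B). *)
Lemma ratio_bound B x E : 0 < B -> 6 * B * E <= x ->
  (2 * B - 1) * (x + E) ^ 2 <= 2 * B * (x * (x - E)).
Proof.
move=> B0 h; have Ex : E <= x by nia.
have [y xE] : exists y, x = 6 * B * E + y by exists (x - 6 * B * E); lia.
subst x; rewrite -mulnn.
have -> : 6 * B * E + y - E = (6 * B - 1) * E + y by nia.
case: B B0 h Ex => // b _ _ _.
have -> : 2 * b.+1 - 1 = 2 * b + 1 by lia.
have -> : 6 * b.+1 - 1 = 6 * b + 5 by lia.
nia.
Qed.

(** This is (1 - 1/(2B))^2 >= 1 - 1/B, cleared of denominators. *)
Lemma ratio_mul B a1 b1 a2 b2 : 0 < B ->
  (2 * B - 1) * b1 <= 2 * B * a1 -> (2 * B - 1) * b2 <= 2 * B * a2 ->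
  (B - 1) * (b1 * b2) <= B * (a1 * a2).
Proof.
case: B => // b _ h1 h2.
have -> : b.+1 - 1 = b by lia.
have E : 2 * b.+1 - 1 = 2 * b + 1 by lia.
rewrite E in h1 h2; have := leq_mul h1 h2; nia.
Qed.

(** [x] and [N] depend only on [k] and [B]; all large [m] are reached by varying [y] and [r]. The
    comparison is with [k ^ 2] instead of [k * k.-1], which leaves the factor 1 - 1/k to be taken
    out later. *)
Lemma main_design k B : adm k -> 2 < k -> 0 < B -> exists m0, forall m, m0 <= m -> adm m ->
  exists n, pbd k n m /\ (B - 1) * m ^ 2 <= B * (n * k ^ 2).
Proof.
move=> ak k3 B0; pose E := 18 * k - 1; pose x := 1 + k`! * (48 * (B * E)).
have fk := fact_gt0 k.
have xE : 6 * B * E <= x by rewrite /x; nia.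
have Ex : E <= x by nia.
have [N [NE G1 G2]] := gdd_mostly_k ak k3 Ex.
have N0 : 0 < N by nia.
pose D := N * N`!; have fN := fact_gt0 N.
have D0 : 0 < D by rewrite muln_gt0 N0.
pose v0 := 6 * B * D.+1.
exists (6 * (N + D * v0 + D) + 6) => m m0 am.
pose c := m %% 6; pose a := m %/ 6.
have mE : m = 6 * a + c by rewrite /a /c; have := divn_eq m 6; lia.
have c13 : c = 1 \/ c = 3 by [].
have c6 : c < 6 by lia.
(* Dividing by N * N! writes a = N y + r with y = 1 + N! v, so that y is prime to 1, ..., N - 1
   while r stays bounded as m grows. *)
pose v := (a - N) %/ D; pose r := (a - N) %% D.
have aN : a = N + D * v + r by have := divn_eq (a - N) D; rewrite -/v -/r; lia.
have rD : r < D by rewrite ltn_pmod.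
have vv0 : v0 <= v by rewrite /v leq_divRL //; lia.
pose y := 1 + N`! * v.
have ay : a = N * y + r by rewrite /y aN /D; lia.
have yv : v < y by rewrite /y add1n ltnS leq_pmull.
have v0y : v0 <= y := ltnW (leq_ltn_trans vv0 yv).
have Dy : D.+1 <= y by apply: leq_trans v0y; rewrite leq_pmull // muln_gt0.
have y2 : y = (y - 2).+2 by clear -Dy D0; lia.
have ry : r <= y by apply: leq_trans Dy; apply: ltnW; apply: ltnW.
have yB : 6 * B * r.+1 <= y by apply: leq_trans v0y; rewrite leq_mul2l ltnS (ltnW rD) orbT.
have st w : pbd k 0 (6 * w + c).
  by apply: sts; rewrite mulnC modnMDl; case: c13 => ->; [left|right].
have cop d : 0 < d < N -> coprime y d by apply: coprime_fact.
exists (y * (y - r) * (x * (x - E))); split.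
  rewrite mE ay; move: ry cop (st y); rewrite y2 => ry cop sy.
  by apply: truncated_design => //; have := st 0; rewrite muln0 add0n.
have h1 := ratio_bound B0 xE; have h2 := ratio_bound B0 yB.
(* [r.+1] instead of [r] absorbs the [c < 6] common points in the bound [mb] on m. *)
have h3 : (2 * B - 1) * (y + r.+1) ^ 2 <= 2 * B * (y * (y - r)).
  by apply: leq_trans h2 _; rewrite !leq_mul2l leq_sub2l ?orbT.
have h4 := ratio_mul B0 h1 h3.
have mb : m <= k * (x + E) * (y + r.+1).
  rewrite -NE mE ay mulnDr !mulnA mulnDr -addnA leq_add2l -mulnA.
  apply: (@leq_trans (6 * r.+1)); first by clear -c6; lia.
  by rewrite leq_mul2l leq_pmull.
apply: (@leq_trans ((B - 1) * (k ^ 2 * ((x + E) ^ 2 * (y + r.+1) ^ 2)))).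
  by rewrite leq_mul2l -!expnMn mulnA leq_sqr mb orbT.
move: h4; set b := (B - 1) * _; set b' := B * (x * _ * _) => h4.
apply: (@leq_trans (k ^ 2 * b)); first by rewrite /b; lia.
apply: (@leq_trans (k ^ 2 * b')); first by rewrite leq_mul2l h4 orbT.
by rewrite /b'; lia.
Qed.

(** * Cyclic triples in tournaments *)

Definition cyclic_on (T : finType) (G : rel T) (b : seq T) : bool :=
  is_copy G C3 [set x in b]%SET.

Definition cyclic3 (T : Type) (G : rel T) (x y z : T) : bool :=
  (G x y && G y z && G z x) || (G y x && G z y && G x z).

Lemma tri_cases (P : 'I_3 -> Prop) :
  P (@Ordinal 3 0 isT) -> P (@Ordinal 3 1 isT) -> P (@Ordinal 3 2 isT) -> forall i, P i.
Proof.
move=> h0 h1 h2 [[|[|[|i]]] hi] //.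
- by rewrite (_ : Ordinal hi = @Ordinal 3 0 isT) //; apply: val_inj.
- by rewrite (_ : Ordinal hi = @Ordinal 3 1 isT) //; apply: val_inj.
- by rewrite (_ : Ordinal hi = @Ordinal 3 2 isT) //; apply: val_inj.
Qed.

Section Copies.
Variables (T : finType) (G : rel T).
Hypothesis tG : tournament G.

Let o0 : 'I_3 := @Ordinal 3 0 isT.
Let o1 : 'I_3 := @Ordinal 3 1 isT.
Let o2 : 'I_3 := @Ordinal 3 2 isT.

Lemma tournament_irr x : G x x = false.
Proof. by case: tG => irr _; apply: irr. Qed.

Lemma tournament_asym x y : x != y -> G y x = ~~ G x y.
Proof. by case: tG => _ as_ xy; rewrite (as_ y x) // eq_sym. Qed.

Lemma is_copyI H (x y z : T) : uniq [:: x; y; z] ->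
  G x y = tri_rel H o0 o1 -> G y z = tri_rel H o1 o2 -> G x z = tri_rel H o0 o2 ->
  is_copy G H [set w in [:: x; y; z]]%SET.
Proof.
move=> u gxy gyz gxz; have := u; rewrite /= !inE negb_or andbT => /andP[/andP[nxy nxz] nyz].
apply/existsP; exists [ffun i : 'I_3 => nth x [:: x; y; z] i]; apply/and3P; split.
- apply/injectiveP => i j; rewrite !ffunE => /eqP; rewrite nth_uniq // => /eqP.
  exact: val_inj.
- apply/eqP/setP => w; rewrite inE; apply/imsetP/idP => [[i _ ->]|].
    by rewrite ffunE mem_nth.
  rewrite !inE => /or3P[]/eqP->; [exists o0|exists o1|exists o2] => //; by rewrite ffunE.
apply/forallP; apply: tri_cases; apply/forallP; apply: tri_cases; rewrite !ffunE /=;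
  rewrite ?tournament_irr ?gxy ?gyz ?gxz ?(tournament_asym nxy) ?(tournament_asym nxz)
    ?(tournament_asym nyz) ?gxy ?gyz ?gxz; by case: (H).
Qed.

Lemma is_copyE H t : is_copy G H t -> exists x y z, [/\ uniq [:: x; y; z],
  t = [set w in [:: x; y; z]]%SET, G x y = tri_rel H o0 o1, G y z = tri_rel H o1 o2
  & G x z = tri_rel H o0 o2].
Proof.
move=> /existsP[f /and3P[/injectiveP fI /eqP <- /forallP h]].
have hh i j : G (f i) (f j) = tri_rel H i j by have /forallP/(_ j)/eqP := h i.
exists (f o0), (f o1), (f o2); split; rewrite ?hh //.
  by rewrite /= !inE !(inj_eq fI).
apply/setP => w; rewrite !inE; apply/imsetP/or3P => [[i _ ->]|].
  by move: i; apply: tri_cases; [apply: Or31|apply: Or32|apply: Or33].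
by case=> /eqP->; [exists o0|exists o1|exists o2].
Qed.

Lemma cyclic_onE x y z : uniq [:: x; y; z] -> cyclic_on G [:: x; y; z] = cyclic3 G x y z.
Proof.
move=> u; have := u; rewrite /= !inE negb_or andbT => /andP[/andP[nxy nxz] nyz].
apply/idP/idP; last first.
  case/orP => /andP[/andP[h1 h2] h3].
    apply: is_copyI => //; rewrite (tournament_asym (_ : z != x)) ?h3 //.
    by rewrite eq_sym.
  rewrite /cyclic_on (_ : [set w in [:: x; y; z]]%SET = [set w in [:: x; z; y]]%SET).
    apply: is_copyI => //; first by rewrite /= !inE negb_or nxy nxz eq_sym nyz.
    by rewrite (tournament_asym (_ : y != x)) ?h1 // eq_sym.
  by apply/setP => w; rewrite !inE orbCA orbC -orbA orbC -orbA [RHS]orbC -orbA; case: (w == x); case: (w == y); case: (w == z).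
move=> /is_copyE[a [b [c [u' E /= gab gbc gac]]]].
have m w : (w \in [:: x; y; z]) = (w \in [:: a; b; c]).
  by have /setP/(_ w) := E; rewrite !inE.
have gca : G c a by rewrite tournament_asym ?gac //; move: u'; rewrite /= !inE negb_or => /andP[/andP[]].
have := m x; have := m y; have := m z.
rewrite !inE !eqxx ?orbT /= => /esym/or3P[]/eqP zE /esym/or3P[]/eqP yE /esym/or3P[]/eqP xE;
  subst x y z; rewrite ?eqxx // in nxy nxz nyz *;
  by rewrite /cyclic3 ?gab ?gbc ?gca ?orbT.
Qed.

Lemma triple_T3 (t : {set T}) : #|t| = 3 -> is_copy G T3 t = ~~ is_copy G C3 t.
Proof.
move=> t3; have [x [y [z [u ->]]]] : exists x y z, uniq [:: x; y; z] /\ t = [set w in [:: x; y; z]]%SET.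
  have := enum_uniq (mem t); have := set_enum t; rewrite cardE in t3; move: t3.
  by case: (enum t) => [|x [|y [|z []]]] // _ <- u; exists x, y, z.
have -> : is_copy G C3 [set w in [:: x; y; z]]%SET = cyclic3 G x y z by apply: cyclic_onE.
apply/idP/idP => [/is_copyE[a [b [c [u' E /= gab gbc gac]]]]|].
  have -> : cyclic3 G x y z = cyclic_on G [:: a; b; c].
    by rewrite -cyclic_onE // /cyclic_on E.
  rewrite cyclic_onE // /cyclic3.
  have := u'; rewrite /= !inE negb_or andbT => /andP[/andP[nab nac] nbc].
  by rewrite (tournament_asym nab) (tournament_asym nac) gab gac /= andbF.
have := u; rewrite /= !inE negb_or andbT => /andP[/andP[nxy nxz] nyz].
have I a b c : uniq [:: a; b; c] -> [set w in [:: x; y; z]]%SET = [set w in [:: a; b; c]]%SET ->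
   G a b -> G b c -> G a c -> is_copy G T3 [set w in [:: x; y; z]]%SET.
  by move=> u' -> h1 h2 h3; apply: is_copyI.
have [nyx nzx nzy] : [/\ y != x, z != x & z != y] by split; rewrite eq_sym.
have tac a b c : uniq [:: a; b; c] -> [:: x; y; z] =i [:: a; b; c] ->
   G a b -> G b c -> G a c -> is_copy G T3 [set w in [:: x; y; z]]%SET.
  by move=> u' p; apply: I => //; apply/setP => w; have := p w; rewrite !inE.
have bools (a b c : bool) : [/\ [|| a, b | c] = [|| a, c | b], [|| a, b | c] = [|| c, a | b],
    [|| a, b | c] = [|| b, a | c], [|| a, b | c] = [|| b, c | a] & [|| a, b | c] = [|| c, b | a]].
  by case: a; case: b; case: c.
rewrite /cyclic3 (tournament_asym nxy) (tournament_asym nxz) (tournament_asym nyz).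
case gxy : (G x y); case gyz : (G y z); case gxz : (G x z) => //= _.
- exact: (tac x y z).
- by apply: (tac x z y); rewrite ?(tournament_asym nyz) ?gyz //= ?inE ?negb_or ?nxz ?nxy ?nzy // => w;
    rewrite !inE; case: (bools (w == x) (w == y) (w == z)).
- by apply: (tac z x y); rewrite ?(tournament_asym nyz) ?(tournament_asym nxz) ?gyz ?gxz //= ?inE ?negb_or ?nzx ?nxy ?nzy // => w;
    rewrite !inE; case: (bools (w == x) (w == y) (w == z)).
- by apply: (tac y x z); rewrite ?(tournament_asym nxy) ?gxy //= ?inE ?negb_or ?nyx ?nyz ?nxz // => w;
    rewrite !inE; case: (bools (w == x) (w == y) (w == z)).
- by apply: (tac y z x); rewrite ?(tournament_asym nxy) ?(tournament_asym nxz) ?gxy ?gxz //= ?inE ?negb_or ?nyx ?nyz ?nzx // => w;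
    rewrite !inE; case: (bools (w == x) (w == y) (w == z)).
- by apply: (tac z y x); rewrite ?(tournament_asym nxy) ?(tournament_asym nxz) ?(tournament_asym nyz) ?gxy ?gxz ?gyz //= ?inE ?negb_or ?nyx ?nzy ?nzx // => w;
    rewrite !inE; case: (bools (w == x) (w == y) (w == z)).
Qed.
End Copies.

(** * Triple systems on the vertices of a tournament *)

Definition triples (T : finType) (M : seq (seq T)) : Prop :=
  blocks 3 M /\ forall x y, x != y -> cover M x y = 1.

Lemma cover_count (T : eqType) (M : seq (seq T)) x y :
  cover M x y = count (fun b => (x \in b) && (y \in b)) M.
Proof.
rewrite /cover; elim: M => [|b M IH]; first by rewrite big_nil.
by rewrite big_cons IH.
Qed.

(** Passing from a list of triples to a set of sets can only merge blocks, so an inequality between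
    the counts comes for free. *)
Lemma triples_set (T : finType) (G : rel T) M : triples M ->
  exists L : {set {set T}}, triangle_decomposition L /\
    num_copies G C3 L <= count (cyclic_on G) M.
Proof.
move=> [bM cM]; pose L := [set t in map (fun b => [set x in b]%SET) M]%SET.
have LP t : reflect (exists2 b, b \in M & t = [set x in b]%SET) (t \in L).
  by rewrite inE; apply: mapP.
exists L; split; [split=> [t /LP[b bIM ->]|x y xy]|].
- have /andP[u /eqP s] := allP bM b bIM.
  by rewrite cardsE (card_uniqP u).
- have := cM x y xy; rewrite cover_count -size_filter.
  case E : (seq.filter _ M) => [|b [|b' s]] // _.
  have : b \in seq.filter (fun b => (x \in b) && (y \in b)) M by rewrite E inE.
  rewrite mem_filter => /andP[/andP[xb yb] bIM].
  rewrite (_ : [set t in L | _]%SET = [set [set x in b]]%SET) ?cards1 //.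
  apply/setP => t; rewrite finset.in_set finset.in_set1; apply/idP/eqP => [/and3P[/LP[b' b'M ->]]|->].
    rewrite !finset.in_set => xb' yb'.
    have : b' \in seq.filter (fun b => (x \in b) && (y \in b)) M.
      by rewrite mem_filter xb' yb'.
    by rewrite E inE => /eqP->.
  by apply/and3P; split; [apply/LP; exists b | rewrite finset.in_set | rewrite finset.in_set].
rewrite /num_copies -size_filter.
apply: leq_trans (_ : #|[seq [set x in b]%SET | b <- seq.filter (cyclic_on G) M]| <= _).
  apply: subset_leq_card; apply/fintype.subsetP => t; rewrite inE => /andP[/LP[b bIM ->] c].
  by apply/mapP; exists b; rewrite ?mem_filter ?bIM ?andbT.
by apply: leq_trans (card_size _) _; rewrite size_map.
Qed.

Lemma card_count (X : finType) (L : {set X}) (P : pred X) :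
  #|[set t in L | P t]%SET| = count P (enum L).
Proof.
rewrite -sum1_card -sum1_count big_enum_cond /=.
by apply: eq_bigl => t; rewrite finset.in_set.
Qed.

Lemma set_triples (T : finType) (G : rel T) (L : {set {set T}}) :
  triangle_decomposition L ->
  exists M, [/\ triples M, size M = #|L| & count (cyclic_on G) M = num_copies G C3 L].
Proof.
move=> [h3 h1]; exists (map (fun t : {set T} => enum t) (enum L)); split.
- split; first by apply/allP => b /mapP[t]; rewrite mem_enum => /h3 t3 ->;
    rewrite enum_uniq -cardE t3.
  move=> x y xy; rewrite cover_count count_map -(h1 x y xy).
  by rewrite card_count; apply: eq_count => t; rewrite /= !mem_enum.
- by rewrite size_map -cardE.
rewrite count_map /num_copies card_count.
by apply: eq_count => t; rewrite /= /cyclic_on set_enum.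
Qed.

(** The bound is uniform in the tournament, so the least such [c] is the worst case that [nu_min]
    measures. Stated with integers, it keeps the combinatorics apart from the reals. *)
Definition few_cyclic (k c : nat) : Prop := forall G : rel 'I_k, tournament G ->
  exists L : {set {set 'I_k}}, triangle_decomposition L /\ num_copies G C3 L <= c.

Lemma tournament_pull (S T : finType) (G : rel T) (f : S -> T) : injective f ->
  tournament G -> tournament (fun i j => G (f i) (f j)).
Proof.
move=> fI [irr as_]; split=> [x|x y xy]; first exact: irr.
by apply: as_; rewrite inj_eq.
Qed.

Lemma cyclic_on_map (S T : finType) (G : rel T) (f : S -> T) (b : seq S) :
  tournament G -> injective f -> uniq b -> size b = 3 ->
  cyclic_on G (map f b) = cyclic_on (fun i j => G (f i) (f j)) b.
Proof.
move=> tG fI u; case: b u => [|x [|y [|z []]]] // u _.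
rewrite (cyclic_onE (tournament_pull fI tG)) //= (cyclic_onE tG) //.
by move: u; rewrite /= !inE !(inj_eq fI).
Qed.

Lemma few_cyclic_block k c (T : finType) (G : rel T) (b : seq T) :
  few_cyclic k c -> tournament G -> uniq b -> size b = k ->
  exists M, [/\ blocks 3 M, forall x y, x != y -> cover M x y = (x \in b) && (y \in b)
     & count (cyclic_on G) M <= c].
Proof.
move=> D tG; case: k D => [|k] D u sb.
  exists [::]; split=> // x y _; rewrite (size0nil sb) /cover big_nil //.
have [x0 _] : exists x0, x0 \in b by case: b sb u => // x0 b; exists x0; rewrite inE eqxx.
pose f (i : 'I_k.+1) := nth x0 b i.
have fI : injective f.
  by move=> i j /eqP; rewrite nth_uniq ?sb // => /eqP/val_inj.
have [L [tL nL]] := D _ (tournament_pull fI tG).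
have [M [[bM cM] _ cnt]] := set_triples (fun i j => G (f i) (f j)) tL.
have mb x : x \in b -> exists i, f i = x.
  move=> xb; have h : index x b < k.+1 by rewrite -sb index_mem.
  by exists (Ordinal h); rewrite /f /= nth_index.
exists (map (map f) M); split.
- by rewrite blocks_map.
- move=> x y xy; case: (boolP (x \in b)) => [/mb[i xi]|nx]; last first.
    rewrite cover_map0 //; left => a; apply: contra nx => /eqP <-.
    by rewrite mem_nth ?sb.
  case: (boolP (y \in b)) => [/mb[j yj]|ny]; last first.
    rewrite cover_map0 //; right => a; apply: contra ny => /eqP <-.
    by rewrite mem_nth ?sb.
  by rewrite -xi -yj cover_map // cM //; apply: contra xy => /eqP; rewrite -xi -yj => ->.
apply: leq_trans nL; rewrite count_map -cnt.
rewrite leq_eqVlt; apply/orP; left; apply/eqP/eq_in_count => b' /(allP bM)/andP[u' /eqP s'] /=.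
by rewrite cyclic_on_map.
Qed.

(** Each block of [L] is replaced by its own triple system, and every triple of [M] is charged as if
    it were cyclic. *)
Lemma assemble (T : finType) (G : rel T) (L M : seq (seq T)) (c : seq T -> nat) :
  (forall x y, x != y -> cover L x y + cover M x y = 1) -> blocks 3 M ->
  (forall b, b \in L -> exists N, [/\ blocks 3 N,
     forall x y, x != y -> cover N x y = (x \in b) && (y \in b)
     & count (cyclic_on G) N <= c b]) ->
  exists N, triples N /\ count (cyclic_on G) N <= \sum_(b <- L) c b + size M.
Proof.
move=> cov bM H.
suff [N [b1 c1 n1]] : exists N, [/\ blocks 3 N,
     forall x y, x != y -> cover N x y = cover L x y
     & count (cyclic_on G) N <= \sum_(b <- L) c b].
  exists (N ++ M); split; last by rewrite count_cat leq_add // count_size.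
  split; first by rewrite /blocks all_cat; apply/andP.
  by move=> x y xy; rewrite cover_cat c1 // cov.
elim: L H {cov} => [|b L IH] H; first by exists [::]; split=> //; rewrite big_nil.
have [|N [b1 c1 n1]] := IH; first by move=> b' h; apply: H; rewrite inE h orbT.
have [N' [b2 c2 n2]] := H b (mem_head _ _).
exists (N' ++ N); split.
- by rewrite /blocks all_cat; apply/andP.
- by move=> x y xy; rewrite cover_cat c1 // c2 // {2}/cover big_cons.
- by rewrite count_cat big_cons leq_add.
Qed.

(** Double counting of ordered pairs of distinct points. *)
Lemma dec_size k n (T : finType) (L M : seq (seq T)) :
  blocks k L -> blocks 3 M -> size L = n ->
  (forall x y, x != y -> cover L x y + cover M x y = 1) ->
  n * (k * k.-1) + size M * 6 = #|T| * #|T|.-1.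
Proof.
have pairs j (B : seq (seq T)) : blocks j B ->
    \sum_(p : T * T | p.1 != p.2) cover B p.1 p.2 = size B * (j * j.-1).
  move=> bB; rewrite /cover exchange_big /= big_seq.
  rewrite (eq_bigr (fun _ => j * j.-1)) => [|b bIB]; last first.
    have /andP[u /eqP sb] := allP bB b bIB.
    rewrite -(pair_big_dep predT (fun x y => x != y) (fun x y => ((x \in b) && (y \in b) : nat))) /=.
    rewrite (eq_bigr (fun x => (x \in b) * j.-1)) => [|x _].
      rewrite -big_distrl /=; congr (_ * _).
      rewrite -sb -(card_uniqP u) -sum1_card [RHS]big_mkcond.
      by apply: eq_bigr => x _; case: (x \in b).
    case: (boolP (x \in b)) => xb /=; last by rewrite big1 ?mul0n.
    rewrite mul1n -sb -(card_uniqP u) (cardD1 x) xb /= -sum1_card.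
    by rewrite big_mkcond [RHS]big_mkcond; apply: eq_bigr => y _; rewrite !inE eq_sym; case: (y == x).
  by rewrite -big_seq big_const_seq count_predT iter_addn_0 mulnC.
move=> bL bM <- cov; rewrite -(pairs k L bL) -[6]/(3 * 3.-1) -(pairs 3 M bM) -big_split /=.
rewrite (eq_bigr (fun _ => 1)) => [|p pp]; last exact: cov.
rewrite -(pair_big_dep predT (fun x y => x != y) (fun _ _ => 1)) /=.
rewrite (eq_bigr (fun _ => #|T|.-1)) => [|x _]; first by rewrite sum_nat_const.
by rewrite sum1_card -(cardC1 x); apply: eq_card => y; rewrite !inE eq_sym.
Qed.

(** * A certificate for tournaments on seven vertices *)

Local Open Scope Z_scope.

(** The certificate is a positive semidefinite matrix of rank at most 4, given by one vector per
    flag. Reversing all arcs permutes the flags, and the vectors follow this symmetry: their two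
    middle coordinates change sign. *)
Definition vec4 : Type := Z * Z * Z * Z.

Definition dot (u v : vec4) : Z :=
  let: (a, b, c, d) := u in let: (a', b', c', d') := v in
  a * a' + b * b' + c * c' + d * d'.

(* Rooted 4-vertex tournaments: [Fabc] when the other three vertices are
   transitive and [a], [b], [c] tell whether the root beats the source, the middle
   vertex and the sink; [Cd] when they are cyclic and the root beats [d] of them. *)
Variant flag4 := F111 | F110 | F101 | F100 | F011 | F010 | F001 | F000
  | C_0 | C_1 | C_2 | C_3.

(* The vectors come from rounding a numerical solution of the semidefinite dual. *)
Definition flag4_vec (f : flag4) : vec4 :=
  match f with
  | F111 => (-5, 1, -12, 7)
  | F110 => (25, 23, -12, -7)
  | F101 => (9, -8, -12, 11)
  | F100 => (25, -23, 12, -7)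
  | F011 => (6, 3, -4, 4)
  | F010 => (9, 8, 12, 11)
  | F001 => (6, -3, 4, 4)
  | F000 => (-5, -1, 12, 7)
  | C_0 => (-19, 21, 11, 5)
  | C_1 => (-26, 13, -2, -7)
  | C_2 => (-26, -13, 2, -7)
  | C_3 => (-19, -21, -11, 5)
  end.

(** Defined transparently, so that each of the 144 entries is stored as a numeral and the exhaustive
    check reads a table instead of multiplying. *)
Definition gram_sig (f g : flag4) : {z : Z | z = dot (flag4_vec f) (flag4_vec g)}.
Proof. by case: f; case: g; eexists; vm_compute. Defined.

Definition gram (f g : flag4) : Z := sval (gram_sig f g).

Lemma gramE f g : gram f g = dot (flag4_vec f) (flag4_vec g).
Proof. exact: svalP (gram_sig f g). Qed.

Definition trans_flag (b1 b2 b3 : bool) : flag4 :=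
  if b1 then if b2 then if b3 then F111 else F110 else if b3 then F101 else F100
  else if b2 then if b3 then F011 else F010 else if b3 then F001 else F000.

Definition cycl_flag (b1 b2 b3 : bool) : flag4 :=
  if b1 then if b2 then if b3 then C_3 else C_2 else if b3 then C_2 else C_1
  else if b2 then if b3 then C_2 else C_1 else if b3 then C_1 else C_0.

(** The arcs inside the triple sort it from source to sink. Repeated vertices still yield some flag
    depending on the root and the triple alone, which the sum over all tuples relies on. *)
Definition flag_of (rx ry rz xy xz yz : bool) : flag4 :=
  if xy then
    if yz then if xz then trans_flag rx ry rz else cycl_flag rx ry rz
    else if xz then trans_flag rx rz ry else trans_flag rz rx ry
  else
    if yz then if xz then trans_flag ry rx rz else trans_flag ry rz rx
    else if xz then cycl_flag rx ry rz else trans_flag rz ry rx.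

Definition flag (e : nat -> nat -> bool) (r x y z : nat) : flag4 :=
  flag_of (e r x) (e r y) (e r z) (e x y) (e x z) (e y z).

Definition flag_term (e : nat -> nat -> bool) (p : seq nat) : Z :=
  if p is [:: r; x; y; z; x'; y'; z'] then gram (flag e r x y z) (flag e r x' y' z')
  else 0.

(** The entries of [p] are placed on the points of the Fano plane with lines {i, i+1, i+3} modulo 7.
    The default 7 makes every line cyclic. *)
Definition fano_cyclic (e : nat -> nat -> bool) (p : seq nat) : nat :=
  if p is [:: a; b; c; d; f; g; h] then
    (cyclic3 e a b d + cyclic3 e b c f + cyclic3 e c d g + cyclic3 e d f h
     + cyclic3 e f g a + cyclic3 e g h b + cyclic3 e h a c)%N
  else 7%N.

Definition all_perms7 : seq (seq nat) := permutations (iota 0%N 7%N).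

Definition sort3 (x y z : nat) : seq nat :=
  if (x <= y)%N then if (y <= z)%N then [:: x; y; z]
    else if (x <= z)%N then [:: x; z; y] else [:: z; x; y]
  else if (x <= z)%N then [:: y; x; z]
    else if (y <= z)%N then [:: y; z; x] else [:: z; y; x].

(** A flag ignores the order of its three non-root vertices and [gram] is symmetric, so the 5040
    terms reduce to 7 * 10 = 70 representatives. *)
Definition canon (p : seq nat) : seq nat :=
  if p is [:: r; x; y; z; x'; y'; z'] then
    let s := sort3 x y z in let s' := sort3 x' y' z' in
    if (head 0%N s <= head 0%N s')%N then r :: s ++ s' else r :: s' ++ s
  else p.

Definition canons : seq (seq nat) := Eval vm_compute in [seq p <- all_perms7 | canon p == p].

(** One labelling for each of the 7!/168 = 30 Fano planes on seven labelled points. Automorphisms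
    are regular on ordered non-collinear triples, so the 24 entries starting with 0, 1, 2 are the
    planes where these points are not collinear; the last six have the line {0, 1, 2}. *)
Definition fano_planes : seq (seq nat) :=
  ([:: [:: 0; 1; 2; 3; 4; 5; 6]; [:: 0; 1; 2; 3; 4; 6; 5]; [:: 0; 1; 2; 3; 5; 4; 6];
   [:: 0; 1; 2; 3; 5; 6; 4]; [:: 0; 1; 2; 3; 6; 4; 5]; [:: 0; 1; 2; 3; 6; 5; 4];
   [:: 0; 1; 2; 4; 3; 5; 6]; [:: 0; 1; 2; 4; 3; 6; 5]; [:: 0; 1; 2; 4; 5; 3; 6];
   [:: 0; 1; 2; 4; 5; 6; 3]; [:: 0; 1; 2; 4; 6; 3; 5]; [:: 0; 1; 2; 4; 6; 5; 3];
   [:: 0; 1; 2; 5; 3; 4; 6]; [:: 0; 1; 2; 5; 3; 6; 4]; [:: 0; 1; 2; 5; 4; 3; 6];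
   [:: 0; 1; 2; 5; 4; 6; 3]; [:: 0; 1; 2; 5; 6; 3; 4]; [:: 0; 1; 2; 5; 6; 4; 3];
   [:: 0; 1; 2; 6; 3; 4; 5]; [:: 0; 1; 2; 6; 3; 5; 4]; [:: 0; 1; 2; 6; 4; 3; 5];
   [:: 0; 1; 2; 6; 4; 5; 3]; [:: 0; 1; 2; 6; 5; 3; 4]; [:: 0; 1; 2; 6; 5; 4; 3];
   [:: 0; 1; 3; 2; 4; 5; 6]; [:: 0; 1; 3; 2; 4; 6; 5]; [:: 0; 1; 3; 2; 5; 4; 6];
   [:: 0; 1; 3; 2; 5; 6; 4]; [:: 0; 1; 3; 2; 6; 4; 5]; [:: 0; 1; 3; 2; 6; 5; 4]])%N.

(* [72 = 2 * 3! * 3!] *)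
Lemma canons_count :
  all (fun q => count_mem q (map canon all_perms7) == 72%N) canons
  && all (fun p => canon p \in canons) all_perms7.
Proof. by vm_compute. Qed.

Lemma canonsP : all (fun q => q \in all_perms7) canons.
Proof. by vm_compute. Qed.

Lemma canons_uniq : uniq canons.
Proof. by vm_compute. Qed.

Lemma fano_planesP : all (fun p => p \in all_perms7) fano_planes.
Proof. by vm_compute. Qed.

Definition lookup (M : seq (seq bool)) (i j : nat) : bool := nth false (nth [::] M i) j.

(* The largest [c] with [13440 * c + 2 * s <= 12480], plus one; [12480 / 13440 = 13 / 14]
   is the average to be proved. *)
Definition fano_limit (s : Z) : nat :=
  if s <=? -7200 then 3%N else if s <=? -480 then 2%N else if s <=? 6240 then 1%N else 0%N.

Definition fano_below (e : nat -> nat -> bool) (k : nat) : bool :=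
  has (fun p => fano_cyclic e p < k)%N fano_planes.

Definition check (M : seq (seq bool)) : bool :=
  fano_below (lookup M)
    (fano_limit (foldr (fun q acc => flag_term (lookup M) q + acc) 0 canons)).

(** The arcs i -> i+1 are prescribed, which leaves 21 - 6 = 15 free arcs: 2^15 cases instead of
    2^21. *)
Definition path_table (s : seq bool) : seq (seq bool) :=
  if s is [:: a02; a03; a04; a05; a06; a13; a14; a15; a16; a24; a25; a26; a35; a36; a46] then
  [:: [:: false; true; a02; a03; a04; a05; a06];
      [:: false; false; true; a13; a14; a15; a16];
      [:: ~~ a02; false; false; true; a24; a25; a26];
      [:: ~~ a03; ~~ a13; false; false; true; a35; a36];
      [:: ~~ a04; ~~ a14; ~~ a24; false; false; true; a46];
      [:: ~~ a05; ~~ a15; ~~ a25; ~~ a35; false; false; true];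
      [:: ~~ a06; ~~ a16; ~~ a26; ~~ a36; ~~ a46; false; false]]
  else [::].

Section PartialEvaluation.
Variables a02 a03 a04 a05 a06 a13 a14 a15 a16 a24 a25 a26 a35 a36 a46 : bool.

Let e := lookup (path_table
  [:: a02; a03; a04; a05; a06; a13; a14; a15; a16; a24; a25; a26; a35; a36; a46]).

(** The tables and lists are unfolded once, at definition time, into an expression in the 15
    Booleans, instead of being traversed in each of the 2^15 cases. *)
Definition path_sum : Z :=
  Eval cbv beta iota zeta delta [e path_table lookup nth canons foldr flag_term flag] in
  foldr (fun q acc => flag_term e q + acc) 0 canons.

Definition path_below (k : nat) : bool :=
  Eval cbv beta iota zeta delta [e path_table lookup nth fano_below fano_planes has
    fano_cyclic cyclic3] in
  fano_below e k.

Definition check_bits : bool := path_below (fano_limit path_sum).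

Lemma check_bitsE : check_bits = check (path_table
  [:: a02; a03; a04; a05; a06; a13; a14; a15; a16; a24; a25; a26; a35; a36; a46]).
Proof. by []. Qed.
End PartialEvaluation.

Fixpoint bfun (n : nat) : Type := if n is n'.+1 then bool -> bfun n' else bool.

Fixpoint all_fun (n : nat) : bfun n -> bool :=
  if n is n'.+1 return bfun n -> bool then fun P => all_fun (P true) && all_fun (P false)
  else id.

Fixpoint bapp (n : nat) : bfun n -> seq bool -> bool :=
  if n is n'.+1 return bfun n -> seq bool -> bool
  then fun P s => bapp (P (head true s)) (behead s) else fun b _ => b.

Lemma all_funP n (P : bfun n) s : all_fun P -> bapp P s.
Proof.
elim: n P s => //= n IH P s /andP[h1 h2].
by case: (head true s); apply: IH.
Qed.

Lemma check_all : @all_fun 15 check_bits.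
Proof. by vm_compute. Qed.

(* Locked, so that conversion never enumerates it. *)
Definition perms7 : seq (seq nat) := locked all_perms7.

Opaque canons fano_planes.

Local Open Scope ring_scope.

Lemma perms7P p : reflect [/\ size p = 7%N, uniq p & all (fun i => i < 7)%N p] (p \in perms7).
Proof.
rewrite /perms7 -lock mem_permutations; apply: (iffP idP) => [h|[s u a]].
  split; first by rewrite (perm_size h) size_iota.
    by rewrite (perm_uniq h) iota_uniq.
  by apply/allP => i; rewrite (perm_mem h) mem_iota.
apply: uniq_perm => //.
have := @uniq_min_size _ p (iota 0%N 7%N) u _ _; case=> //.
  by move=> i /(allP a); rewrite mem_iota.
by rewrite s size_iota.
Qed.

Lemma perms7_uniq : uniq perms7.
Proof. by rewrite /perms7 -lock; apply: permutations_uniq. Qed.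

Definition tour7 (e : nat -> nat -> bool) : Prop :=
  (forall i j, (i < 7)%N -> (j < 7)%N -> i != j -> e j i = ~~ e i j) /\
  (forall i, (i < 7)%N -> e i i = false).

Lemma flag_term_map e (f : nat -> nat) p :
  flag_term e (map f p) = flag_term (fun i j => e (f i) (f j)) p.
Proof. by case: p => [|? [|? [|? [|? [|? [|? [|? []]]]]]]]. Qed.

Lemma fano_cyclic_map e (f : nat -> nat) p :
  fano_cyclic e (map f p) = fano_cyclic (fun i j => e (f i) (f j)) p.
Proof. by case: p => [|? [|? [|? [|? [|? [|? [|? []]]]]]]]. Qed.

Lemma flag_term_ext e e' p : (forall i j, (i < 7)%N -> (j < 7)%N -> e i j = e' i j) ->
  p \in perms7 -> flag_term e p = flag_term e' p.
Proof.
move=> E /perms7P[s _ a]; case: p s a => [|p0 [|p1 [|p2 [|p3 [|p4 [|p5 [|p6 []]]]]]]] //= _.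
rewrite andbT => /and5P[h0 h1 h2 h3 /and3P[h4 h5 h6]].
by rewrite /flag !E.
Qed.

Lemma fano_cyclic_ext e e' p : (forall i j, (i < 7)%N -> (j < 7)%N -> e i j = e' i j) ->
  p \in perms7 -> fano_cyclic e p = fano_cyclic e' p.
Proof.
move=> E /perms7P[s _ a]; case: p s a => [|p0 [|p1 [|p2 [|p3 [|p4 [|p5 [|p6 []]]]]]]] //= _.
rewrite andbT => /and5P[h0 h1 h2 h3 /and3P[h4 h5 h6]].
by rewrite /cyclic3 !E.
Qed.

Lemma gramC f g : gram f g = gram g f.
Proof.
rewrite !gramE; case: (flag4_vec f) (flag4_vec g) => [[[a b] c] d] [[[a' b'] c'] d'].
by rewrite /dot; lia.
Qed.

Lemma flag_term_canon e p : tour7 e -> p \in perms7 ->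
  flag_term e (canon p) = flag_term e p.
Proof.
move=> [as_ _] /perms7P[s u a].
case: p s u a => [|r [|x [|y [|z [|x' [|y' [|z' []]]]]]]] // _ u a.
have A i j : i \in [:: r; x; y; z; x'; y'; z'] -> j \in [:: r; x; y; z; x'; y'; z'] ->
    i != j -> e j i = ~~ e i j.
  by move=> hi hj; apply: as_; apply: (allP a).
have sortE a1 a2 a3 b1 b2 b3 : e a2 a1 = ~~ e a1 a2 -> e a3 a1 = ~~ e a1 a3 ->
    e a3 a2 = ~~ e a2 a3 -> sort3 a1 a2 a3 = [:: b1; b2; b3] ->
    flag e r b1 b2 b3 = flag e r a1 a2 a3.
  move=> h1 h2 h3; rewrite /sort3.
  have [h1' h2' h3'] : [/\ e a1 a2 = ~~ e a2 a1, e a1 a3 = ~~ e a3 a1 & e a2 a3 = ~~ e a3 a2].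
    by rewrite h1 h2 h3 !negbK.
  do 3?case: ifP => _; move=> [<- <- <-]; rewrite /flag ?h1' ?h2' ?h3';
  by case: (e a2 a1); case: (e a3 a1); case: (e a3 a2); case: (e r a1); case: (e r a2);
    case: (e r a3).
have sortS a1 a2 a3 : exists b1 b2 b3, sort3 a1 a2 a3 = [:: b1; b2; b3].
  by rewrite /sort3; do 3?case: ifP => _; do 3!eexists.
have [b1 [b2 [b3 E]]] := sortS x y z.
have [b1' [b2' [b3' E']]] := sortS x' y' z'.
rewrite /canon E E' /= .
have F : flag e r b1 b2 b3 = flag e r x y z.
  apply: sortE E; apply: A; rewrite ?inE ?eqxx ?orbT //;
  by apply: contraL u => /eqP->; rewrite /= !inE eqxx ?orbT ?andbF.
have F' : flag e r b1' b2' b3' = flag e r x' y' z'.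
  apply: sortE E'; apply: A; rewrite ?inE ?eqxx ?orbT //;
  by apply: contraL u => /eqP->; rewrite /= !inE eqxx ?orbT ?andbF.
by case: ifP => _ /=; rewrite F F' // gramC.
Qed.

Lemma sum_fibres (S : eqType) (s c : seq S) (g : S -> S) (F : S -> Z) :
  uniq c -> (forall p, p \in s -> g p \in c) ->
  \sum_(p <- s) F (g p) = \sum_(q <- c) F q *+ count_mem q (map g s).
Proof.
move=> uc; elim: s => [|p s IH] h; first by rewrite big_nil big1.
rewrite big_cons IH => [|p' hp']; last by apply: h; rewrite inE hp' orbT.
rewrite [RHS](eq_bigr (fun q => F q *+ (g p == q) + F q *+ count_mem q (map g s))) => [|q _];
  last exact: mulrnDr.
rewrite big_split /=; congr (_ + _).
rewrite (bigD1_seq (g p)) ?h ?mem_head //= eqxx mulr1n big1 ?addr0 // => q.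
by rewrite eq_sym => /negPf->.
Qed.

Lemma flag_sum_canon e : tour7 e ->
  \sum_(p <- perms7) flag_term e p = (\sum_(q <- canons) flag_term e q) *+ 72.
Proof.
move=> te; have := canons_count; rewrite [all_perms7]lock => /andP[/allP cc /allP pc].
have uc := canons_uniq.
transitivity (\sum_(p <- perms7) flag_term e (canon p)).
  by rewrite big_seq [RHS]big_seq; apply: eq_bigr => p hp; rewrite flag_term_canon.
rewrite (sum_fibres _ uc pc) -sumrMnl big_seq [RHS]big_seq.
by apply: eq_bigr => q /cc/eqP->.
Qed.

Lemma perms7_relabel t p : t \in perms7 -> p \in perms7 -> map (nth 0%N t) p \in perms7.
Proof.
move=> /perms7P[s u a] /perms7P[s' u' a']; apply/perms7P; split.
- by rewrite size_map.
- rewrite map_inj_in_uniq // => i j /(allP a') hi /(allP a') hj /eqP.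
  by rewrite nth_uniq ?s // => /eqP.
- by apply/allP => _ /mapP[i /(allP a') hi ->]; apply: (allP a); rewrite mem_nth ?s.
Qed.

Lemma perms7_relabel_perm t : t \in perms7 -> perm_eq (map (map (nth 0%N t)) perms7) perms7.
Proof.
move=> ht; have up := perms7_uniq.
have um : uniq (map (map (nth 0%N t)) perms7).
  have /perms7P[s u a] := ht.
  rewrite map_inj_in_uniq // => p p' /perms7P[_ _ hp] /perms7P[_ _ hp'].
  move=> E; have s12 : size p = size p' by have := congr1 size E; rewrite !size_map.
  apply: (@eq_from_nth _ 0%N) => // i ip; have ip' := ip; rewrite s12 in ip'.
  have := congr1 (nth 0%N ^~ i) E; rewrite /= !(nth_map 0%N) // => /eqP.
  have hi := allP hp _ (mem_nth 0%N ip); have hi' := allP hp' _ (mem_nth 0%N ip').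
  by rewrite nth_uniq ?s // => /eqP.
apply: uniq_perm => //.
have := @uniq_min_size _ (map (map (nth 0%N t)) perms7) perms7 um _ _; case=> //.
  by move=> _ /mapP[p hp ->]; apply: perms7_relabel.
by rewrite size_map.
Qed.

Local Open Scope Z_scope.

Lemma fano_limitP s c : (c < fano_limit s)%N -> 13440 * Z.of_nat c + 2 * s <= 12480.
Proof.
rewrite /fano_limit; do 3?case: Z.leb_spec0 => ?; move=> ?; lia.
Qed.

(** Divided by 13440, the inequality reads c + M/96 <= 13/14, where M is the mean of the 70
    representative flag terms. *)
Lemma fano_path e : tour7 e -> (forall i, (i < 6)%N -> e i i.+1) ->
  exists2 p, p \in perms7 &
    13440 * Z.of_nat (fano_cyclic e p) + 2 * (\sum_(q <- canons) flag_term e q)%R <= 12480.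
Proof.
move=> [as_ irr] pth.
pose M := path_table [:: e 0%N 2%N; e 0%N 3%N; e 0%N 4%N; e 0%N 5%N; e 0%N 6%N; e 1%N 3%N; e 1%N 4%N; e 1%N 5%N; e 1%N 6%N;
  e 2%N 4%N; e 2%N 5%N; e 2%N 6%N; e 3%N 5%N; e 3%N 6%N; e 4%N 6%N].
have ME i j : (i < 7)%N -> (j < 7)%N -> lookup M i j = e i j.
  have up k : (k < 6)%N -> e k.+1 k = false.
    by move=> k6; rewrite (as_ k k.+1) ?pth ?(leqW k6) // neq_ltn ltnSn.
  move: i j => [|[|[|[|[|[|[|i]]]]]]] [|[|[|[|[|[|[|j]]]]]]] // _ _;
  by rewrite /lookup /M /= ?irr ?pth ?up // -as_.
have : check M.
  rewrite -check_bitsE.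
  exact: (@all_funP 15 check_bits [:: e 0%N 2%N; e 0%N 3%N; e 0%N 4%N; e 0%N 5%N; e 0%N 6%N; e 1%N 3%N; e 1%N 4%N; e 1%N 5%N;
    e 1%N 6%N; e 2%N 4%N; e 2%N 5%N; e 2%N 6%N; e 3%N 5%N; e 3%N 6%N; e 4%N 6%N] check_all).
rewrite /check /fano_below => /hasP[p pF]; have pP : p \in perms7 by rewrite /perms7 -lock; apply: (allP fano_planesP).
set S := foldr _ _ _; have -> : S = \sum_(q <- canons) flag_term e q.
  rewrite {}/S; have : all (fun q => q \in perms7) canons by have := canonsP; rewrite [all_perms7]lock.
  elim: canons => [|q c IH] /=; first by rewrite big_nil.
  by case/andP => hq hc; rewrite big_cons -IH // (flag_term_ext ME hq).
by rewrite (fano_cyclic_ext ME pP) => /fano_limitP h; exists p.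
Qed.

(** Merge sort needs only totality, not transitivity, to put each entry in relation with the next
    one; sorting the vertices by the arcs therefore yields a Hamiltonian path. *)
Lemma hamiltonian e : tour7 e ->
  exists2 t, t \in perms7 & forall i, (i < 6)%N -> e (nth 0%N t i) (nth 0%N t i.+1).
Proof.
(* The relation is padded on the diagonal and beyond 6 to be total on [nat]; on distinct indices
   below 7 it is [e]. *)
move=> [as_ irr]; pose r i j := [|| e i j, i == j, 7 <= i | 7 <= j]%N.
have rtot : total r.
  move=> i j; rewrite /r; case: (eqVneq i j) => [->|ij]; first by rewrite ?eqxx ?orbT.
  case: (leqP 7 i) => i7; first by rewrite !orbT.
  case: (leqP 7 j) => j7; first by rewrite !orbT.
  by rewrite (as_ i j i7 j7 ij); case: (e i j).
have tP : sort r (iota 0%N 7%N) \in perms7.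
  apply/perms7P; rewrite size_sort size_iota sort_uniq iota_uniq; split=> //.
  by apply/allP => i; rewrite mem_sort mem_iota.
exists (sort r (iota 0%N 7%N)) => // i i6; have /perms7P[s u a] := tP.
have /(sortedP 0%N)/(_ i) := sort_sorted rtot (iota 0%N 7%N).
rewrite s ltnS => /(_ i6); rewrite /r nth_uniq ?s //; last exact: ltnW.
have n7 k : (k < 7)%N -> (7 <= nth 0%N (sort r (iota 0%N 7%N)) k)%N = false.
  by move=> k7; apply/negbTE; rewrite -ltnNge; apply: (allP a); rewrite mem_nth ?s.
by rewrite -/r !n7 ?(leqW i6) // ?(ltn_eqF (ltnSn i)) ?orbF.
Qed.

(** The flag sum over all orderings does not change when the vertices are renumbered along a
    Hamiltonian path. It is 72 times the sum over representatives, whence the constants of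
    [fano_path] times 36. *)
Lemma fano_cert e : tour7 e -> exists2 p, p \in perms7 &
  483840 * Z.of_nat (fano_cyclic e p) + (\sum_(q <- perms7) flag_term e q)%R <= 449280.
Proof.
move=> te; have [t tP pth] := hamiltonian te; have /perms7P[s u a] := tP.
pose e' (i j : nat) := e (nth 0%N t i) (nth 0%N t j).
have te' : tour7 e'.
  case: te => as_ irr; split=> [i j i7 j7 ij|i i7]; last first.
    by apply: irr; apply: (allP a); rewrite mem_nth ?s.
  by apply: as_; rewrite ?(allP a) ?mem_nth ?s ?nth_uniq ?s.
have [p pP h] := fano_path te' pth.
exists (map (nth 0%N t) p); first exact: perms7_relabel.
rewrite -(perm_big _ (perms7_relabel_perm tP)) big_map.
have -> : fano_cyclic e (map (nth 0%N t) p) = fano_cyclic e' p := fano_cyclic_map _ _ _.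
rewrite (eq_bigr (flag_term e')) => [|q _]; last exact: flag_term_map.
move: h; rewrite (flag_sum_canon te').
move: (\sum_(q <- canons) _)%R (fano_cyclic _ _) => S c.
have -> : (S *+ 72)%R = 72 * S by rewrite -mulr_natl.
lia.
Qed.

Local Close Scope Z_scope.

(** * Averaging over all 7-sets *)

Local Open Scope nat_scope.

Lemma extend_perm (V : finType) (b b' : seq V) : uniq b -> uniq b' -> size b = size b' ->
  exists s : {perm V}, map s b = b'.
Proof.
move=> ub ub' sb; pose rest (c : seq V) := [seq x <- enum V | x \notin c].
have uc (c : seq V) : uniq c -> uniq (c ++ rest c).
  move=> u; rewrite cat_uniq u filter_uniq ?enum_uniq // andbT /=.
  by apply/hasPn => x; rewrite mem_filter => /andP[].
have mc (c : seq V) x : x \in c ++ rest c.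
  by rewrite mem_cat mem_filter mem_enum andbT orbN.
have sc (c : seq V) : uniq c -> size (c ++ rest c) = #|V|.
  by move=> u; rewrite -(card_uniqP (uc c u)); apply: eq_card => x; rewrite mc.
case: b ub sb => [|x0 b0] ub sb; first by exists 1%g; case: b' ub' sb.
set b := x0 :: b0 in ub sb *.
pose f x := nth x0 (b' ++ rest b') (index x (b ++ rest b)).
have ix x : index x (b ++ rest b) < size (b' ++ rest b').
  by rewrite sc // -(sc b) // index_mem mc.
have fI : injective f.
  move=> x y /eqP; rewrite nth_uniq ?uc // => /eqP.
  exact: index_inj.
exists (perm fI); apply: (@eq_from_nth _ x0); first by rewrite size_map.
move=> i; rewrite size_map => ib; rewrite (nth_map x0) // permE /f.
by rewrite index_cat mem_nth // index_uniq // nth_cat -sb ib.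
Qed.

(* Every injective tuple has equally many images under permutations. *)
Lemma perm_average (V : finType) k (F : k.-tuple V -> nat) (b : k.-tuple V) : uniq b ->
  (\sum_(s : {perm V}) F (map_tuple s b)) * #|V| ^_ k
   = #|{perm V}| * \sum_(x : k.-tuple V | uniq x) F x.
Proof.
move=> ub; pose S (x : k.-tuple V) := \sum_(s : {perm V}) F (map_tuple s x).
have Sc (x : k.-tuple V) : uniq x -> S x = S b.
  move=> ux; have [t tE] := extend_perm ub ux (etrans (size_tuple b) (esym (size_tuple x))).
  rewrite /S [RHS](reindex_inj (mulgI t)); apply: eq_bigr => s _; congr F.
  by apply: val_inj; rewrite /= -tE -map_comp; apply: eq_map => v; rewrite /= permM.
have -> : #|V| ^_ k = \sum_(x : k.-tuple V | uniq x) 1.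
  rewrite -(card_uniq_tuples k (fun _ : V => true)) -sum1_card.
  by apply: eq_bigl => x; rewrite finset.in_set all_predT.
rewrite mulnC big_distrl /=; transitivity (\sum_(x : k.-tuple V | uniq x) S x).
  by apply: eq_bigr => x ux; rewrite mul1n Sc.
rewrite exchange_big /= -sum_nat_const; apply: eq_bigr => s _.
have mI : injective (fun x : k.-tuple V => map_tuple s x).
  by move=> x y /(congr1 val)/= /(inj_map (@perm_inj _ s))/val_inj.
rewrite [RHS](reindex_inj mI); apply: eq_bigl => x /=.
by rewrite map_inj_uniq //; apply: perm_inj.
Qed.

(** A union bound: a tuple with a repetition is given by the pair of positions that agree and by [k]
    entries. *)
Lemma expn_ffact n k : n ^ k.+1 <= n ^_ k.+1 + 'C(k.+1, 2) * n ^ k.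
Proof.
elim: k => [|k IH]; first by rewrite ffactn1 expn1 leq_addr.
rewrite [n ^ k.+2]expnS ffactnSr.
apply: leq_trans (leq_mul (leqnn n) IH) _.
have fe : n ^_ k.+1 <= n ^ k.+1.
  elim: (k.+1) => // j IHj; rewrite ffactnSr expnS mulnC.
  by apply: leq_mul => //; apply: leq_subr.
rewrite mulnDr mulnCA -expnS ['C(k.+2, 2)]binS bin1 [(_ + k.+1) * _]mulnDl.
have h1 : n * n ^_ k.+1 <= n ^_ k.+1 * (n - k.+1) + k.+1 * n ^_ k.+1.
  by rewrite [k.+1 * _]mulnC -mulnDr mulnC leq_mul2l; apply/orP; right; lia.
have h2 : k.+1 * n ^_ k.+1 <= k.+1 * n ^ k.+1 by rewrite leq_mul2l fe orbT.
apply: leq_trans (leq_add h1 (leqnn _)) _.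
by rewrite -addnA leq_add2l addnC leq_add2l.
Qed.

Section Averaging.
Variables (V : finType) (G : rel V) (x0 : V).
Hypothesis tG : tournament G.

Definition tuple_rel (x : seq V) (i j : nat) : bool := G (nth x0 x i) (nth x0 x j).

Lemma tuple_rel_tour7 x : size x = 7 -> uniq x -> tour7 (tuple_rel x).
Proof.
move=> s u; split=> [i j i7 j7 ij|i _]; last exact: tournament_irr.
by apply: tournament_asym => //; rewrite nth_uniq ?s.
Qed.

Local Notation id7 := (iota 0 7).

(** Permuting positions permutes the injective tuples, so all 5040 orderings contribute the same
    total. *)
Lemma tuple_reindex p : p \in perms7 ->
  (\sum_(x : 7.-tuple V | uniq x) flag_term (tuple_rel x) p
    = \sum_(x : 7.-tuple V | uniq x) flag_term (tuple_rel x) id7)%R.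
Proof.
move=> /perms7P[s u a].
have sh (x : 7.-tuple V) : size (map (nth x0 x) p) == 7 by rewrite size_map s.
pose h (x : 7.-tuple V) : 7.-tuple V := Tuple (sh x).
have pi : perm_eq p id7.
  have : p \in perms7 by apply/perms7P.
  by rewrite /perms7 -lock mem_permutations.
have hI : injective h.
  move=> x y /(congr1 val) /= E; apply: val_inj.
  apply: (@eq_from_nth _ x0); rewrite ?size_tuple // => i i7.
  have ip : i \in p by rewrite (perm_mem pi) mem_iota.
  have := congr1 (nth x0 ^~ (index i p)) E.
  by rewrite /= !(nth_map 0) ?index_mem // nth_index.
rewrite [RHS](reindex_inj hI) /=; apply: eq_big => [x|x _].
  have -> : uniq (map (nth x0 x) p) = uniq (map (nth x0 x) id7).
    by apply: perm_uniq; apply: perm_map.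
  have E := mkseq_nth x0 x; rewrite size_tuple in E.
  by rewrite -[map _ id7]/(mkseq (nth x0 x) 7) E.
by case: p s {u a sh h pi hI} => [|? [|? [|? [|? [|? [|? [|? []]]]]]]].
Qed.

(** A crude bound is enough: it enters only the error from tuples with repetitions. *)
Lemma gram_le f g : Z.le (gram f g) 2704.
Proof. by apply/Z.leb_le; case: f; case: g. Qed.

Definition root_flag (r : V) (u : 3.-tuple V) : flag4 :=
  flag_of (G r (nth x0 u 0)) (G r (nth x0 u 1)) (G r (nth x0 u 2))
    (G (nth x0 u 0) (nth x0 u 1)) (G (nth x0 u 0) (nth x0 u 2)) (G (nth x0 u 1) (nth x0 u 2)).

(* Summing over all tuples, repetitions allowed, gives a sum of squares. *)
Lemma sum_flag_ge0 : (0 <= \sum_(x : 7.-tuple V) flag_term (tuple_rel x) id7)%R.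
Proof.
(* A 7-tuple is a root with two independent triples, so for a fixed root the sum becomes the squared
   norm of one vector. *)
pose h (t : V * 3.-tuple V * 3.-tuple V) : 7.-tuple V := [tuple of t.1.1 :: t.1.2 ++ t.2].
have hI : injective h.
  move=> [[r u] w] [[r' u'] w'] /(congr1 val) [/= -> /eqP].
  by rewrite eqseq_cat ?size_tuple // => /andP[/eqP/val_inj-> /eqP/val_inj->].
have hB : bijective h.
  by apply: inj_card_bij => //; rewrite !card_prod !card_tuple -expnS -expnD.
rewrite (reindex h) /=; last exact: onW_bij.
rewrite (eq_bigr (fun t => gram (root_flag t.1.1 t.1.2) (root_flag t.1.1 t.2))); last first.
  move=> [[r u] w] _; rewrite /h /=.
  by case/tupleP: u => u0 /tupleP[u1 /tupleP[u2 u]]; rewrite (tuple0 u);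
     case/tupleP: w => w0 /tupleP[w1 /tupleP[w2 w]]; rewrite (tuple0 w).
rewrite -(pair_bigA _ (fun ru w => gram (root_flag ru.1 ru.2) (root_flag ru.1 w))) /=.
rewrite -(pair_bigA _ (fun r u => \sum_w gram (root_flag r u) (root_flag r w)))%R /=.
apply: sumr_ge0 => r _.
pose c0 (u : 3.-tuple V) := (flag4_vec (root_flag r u)).1.1.1.
pose c1 (u : 3.-tuple V) := (flag4_vec (root_flag r u)).1.1.2.
pose c2 (u : 3.-tuple V) := (flag4_vec (root_flag r u)).1.2.
pose c3 (u : 3.-tuple V) := (flag4_vec (root_flag r u)).2.
rewrite (eq_bigr (fun u => \sum_w (c0 u * c0 w + c1 u * c1 w + c2 u * c2 w + c3 u * c3 w)))%R;
  last first.
  move=> u _; apply: eq_bigr => w _; rewrite gramE /c0 /c1 /c2 /c3.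
  by case: (flag4_vec _) (flag4_vec _) => [[[a b] c] d] [[[a' b'] c'] d'].
under eq_bigr do rewrite !big_split /=.
rewrite !big_split /= -!big_distrlr /=.
by rewrite !addr_ge0 // -expr2 sqr_ge0.
Qed.

Local Open Scope Z_scope.

Lemma Z_of_nat_sum (I : Type) (r : seq I) (P : pred I) (F : I -> nat) :
  Z.of_nat (\sum_(i <- r | P i) F i)%N = (\sum_(i <- r | P i) Z.of_nat (F i))%R.
Proof. exact: (big_morph Z.of_nat Nat2Z.inj_add erefl). Qed.

Lemma Z_ler_sum (I : Type) (r : seq I) (P : pred I) (E F : I -> Z) :
  (forall i, P i -> E i <= F i) ->
  (\sum_(i <- r | P i) E i)%R <= (\sum_(i <- r | P i) F i)%R.
Proof.
move=> h; apply: (big_ind2 (fun x y => x <= y) (Z.le_refl 0)) => // a b c d.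
exact: Z.add_le_mono.
Qed.

Lemma Z_sum_const (I : finType) (P : pred I) (c : Z) :
  (\sum_(i | P i) c)%R = c * Z.of_nat #|P|.
Proof.
rewrite sumr_const; elim: (#|P|) => [|m IH]; first by rewrite mulr0n; lia.
by rewrite mulrS IH Nat2Z.inj_succ -[(c + _)%R]/(c + _); lia.
Qed.

Lemma card_uniq7 : #|[pred x : 7.-tuple V | uniq x]| = (#|V| ^_ 7)%N.
Proof.
rewrite -(card_uniq_tuples 7 (fun _ : V => true)) -!sum1_card.
by apply: eq_bigl => x; rewrite finset.in_set all_predT.
Qed.

Lemma card_nonuniq7 : (#|[pred x : 7.-tuple V | ~~ uniq x]| <= 21 * #|V| ^ 6)%N.
Proof.
have := cardC [pred x : 7.-tuple V | uniq x]; rewrite card_uniq7 card_tuple.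
rewrite (eq_card (B := [pred x : 7.-tuple V | ~~ uniq x])) // => E.
by have := expn_ffact #|V| 6; rewrite -E leq_add2l.
Qed.

(** The non-injective tuples, at most 21 n^6 of them, contribute at most 2704 each, and 56784 = 21 *
    2704. *)
Lemma sum_uniq_flag :
  - (56784 * Z.of_nat (#|V| ^ 6)%N) <=
    (\sum_(x : 7.-tuple V | uniq x) flag_term (tuple_rel x) id7)%R.
Proof.
have h0 : 0 <= (\sum_(x : 7.-tuple V) flag_term (tuple_rel x) id7)%R.
  by have := sum_flag_ge0 => /Z.leb_le.
rewrite (bigID (fun x : 7.-tuple V => uniq x)) /= in h0.
have h1 : (\sum_(x : 7.-tuple V | ~~ uniq x) flag_term (tuple_rel x) id7)%R
    <= (\sum_(x : 7.-tuple V | ~~ uniq x) 2704)%R.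
  by apply: Z_ler_sum => x _; apply: gram_le.
rewrite Z_sum_const in h1; have := card_nonuniq7.
move: h0 h1; rewrite -[(_ + _)%R]/(_ + _).
move: (\sum_(x | uniq _) _)%R (\sum_(x | ~~ _) _)%R #|_| (_ ^ _)%N => a b c d.
lia.
Qed.

Lemma fano_average : exists p : 7.-tuple V -> seq nat,
  (forall x : 7.-tuple V, uniq x -> p x \in perms7) /\
  (14 * (\sum_(x : 7.-tuple V | uniq x) fano_cyclic (tuple_rel x) (p x))
    <= 13 * #|V| ^_ 7 + 91 * (91 * #|V| ^ 6))%N.
Proof.
have /choice[p hp] : forall x : 7.-tuple V, exists q : seq nat, uniq x -> q \in perms7 /\
   483840 * Z.of_nat (fano_cyclic (tuple_rel x) q)
     + (\sum_(q <- perms7) flag_term (tuple_rel x) q)%R <= 449280.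
  move=> x; case: (boolP (uniq x)) => [u|nu]; last by exists [::].
  by have [q qP h] := fano_cert (tuple_rel_tour7 (size_tuple x) u); exists q.
exists p; split=> [x /hp[]//|].
pose F (x : 7.-tuple V) := fano_cyclic (tuple_rel x) (p x).
pose S (x : 7.-tuple V) := (\sum_(q <- perms7) flag_term (tuple_rel x) q)%R.
pose E x := 483840 * Z.of_nat (F x) + S x; pose c := 449280.
have h0 : (\sum_(x : 7.-tuple V | uniq x) E x)%R <= (\sum_(x : 7.-tuple V | uniq x) c)%R.
  by apply: Z_ler_sum => x /hp[].
rewrite Z_sum_const card_uniq7 in h0.
have h1 : (\sum_(x : 7.-tuple V | uniq x) E x)%R =
   483840 * Z.of_nat (\sum_(x : 7.-tuple V | uniq x) F x)%N +
   5040 * (\sum_(x : 7.-tuple V | uniq x) flag_term (tuple_rel x) id7)%R.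
  rewrite Z_of_nat_sum [LHS]big_split; congr Z.add; first by rewrite -big_distrr.
  rewrite exchange_big big_seq (eq_bigr (fun _ =>
    (\sum_(x : 7.-tuple V | uniq x) flag_term (tuple_rel x) id7)%R)); last first.
    by move=> q; apply: tuple_reindex.
  have -> : 5040 = Z.of_nat (size perms7) by rewrite /perms7 -lock; vm_compute.
  rewrite -big_seq; move: (\sum_(x | uniq _) _)%R => y.
  elim: perms7 => [|q r IH]; first by rewrite big_nil.
  rewrite big_cons IH [size _]/= Nat2Z.inj_succ.
  by change (y + Z.of_nat (size r) * y = Z.succ (Z.of_nat (size r)) * y); lia.
rewrite h1 {h1} in h0.
have h2 := sum_uniq_flag.
change (14 * (\sum_(x : 7.-tuple V | uniq x) F x) <= 13 * #|V| ^_ 7 + 91 * (91 * #|V| ^ 6))%N.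
move: h0 h2; rewrite /c.
move: (\sum_(x : 7.-tuple V | uniq x) flag_term _ _)%R (\sum_(x | _) F x)%N => S' T.
move: (#|V| ^_ 7)%N (#|V| ^ 6)%N => a b h2 h3.
(* Division by 34560: 483840, 449280 and 5040 * 56784 become 14, 13 and 8281 = 91 * 91. *)
have h4 : 14 * Z.of_nat T <= 13 * Z.of_nat a + 8281 * Z.of_nat b by lia.
lia.
Qed.
End Averaging.

(** * Filling the blocks of a design placed on a tournament *)

Lemma fano_block (V : finType) (G : rel V) (x0 : V) (x : seq V) (p : seq nat) :
  tournament G -> uniq x -> size x = 7 -> p \in perms7 ->
  exists N, [/\ blocks 3 N, forall u v, u != v -> cover N u v = (u \in x) && (v \in x)
    & count (cyclic_on G) N = fano_cyclic (tuple_rel G x0 x) p].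
Proof.
move=> tG ux sx /perms7P[sp up ap].
pose f (i : 'I_7) := nth x0 x (nth 0 p i).
have lt7 i : i < 7 -> nth 0 p i < 7 by move=> i7; apply: (allP ap); rewrite mem_nth ?sp.
have fI : injective f.
  move=> i j /eqP; rewrite nth_uniq ?sx ?lt7 // nth_uniq ?sp // => /eqP.
  exact: val_inj.
pose o (i : nat) : 'I_7 := inZp i.
pose N0 := map (map o) [:: [:: 0; 1; 3]; [:: 1; 2; 4]; [:: 2; 3; 5]; [:: 3; 4; 6];
  [:: 4; 5; 0]; [:: 5; 6; 1]; [:: 6; 0; 2]].
have b0 : blocks 3 N0 by vm_compute.
have c0 i j : i != j -> cover N0 i j = 1.
  rewrite /cover unlock.
  by move: i j => [[|[|[|[|[|[|[|i]]]]]]] hi] [[|[|[|[|[|[|[|j]]]]]]] hj] // _; vm_compute.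
have fx u : u \in x -> exists i, f i = u.
  move=> ux'; have ix : index u x < 7 by rewrite -sx index_mem.
  have ip : index u x \in p.
    have sub : {subset p <= iota 0 7} by move=> i /(allP ap) i7; rewrite mem_iota.
    have s7 : size (iota 0 7) <= size p by rewrite sp.
    by have [_ ->] := uniq_min_size up sub s7; rewrite mem_iota.
  have h : index (index u x) p < 7 by rewrite -sp index_mem.
  by exists (Ordinal h); rewrite /f /= !nth_index.
have xf i : f i \in x by rewrite mem_nth // sx lt7.
exists (map (map f) N0); split.
- by rewrite blocks_map.
- move=> u v uv; case: (boolP (u \in x)) => [/fx[i iu]|nx]; last first.
    by rewrite cover_map0 //; left => a; apply: contra nx => /eqP <-.
  case: (boolP (v \in x)) => [/fx[j jv]|nx]; last first.
    by rewrite cover_map0 //; right => a; apply: contra nx => /eqP <-.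
  by rewrite -iu -jv cover_map // c0 //; apply: contra uv => /eqP; rewrite -iu -jv => ->.
have cE i j k : uniq [:: i; j; k] -> cyclic_on G (map f [:: i; j; k]) = cyclic3 G (f i) (f j) (f k).
  move=> u; have u' : uniq (map f [:: i; j; k]) by rewrite (map_inj_uniq fI).
  by rewrite /= (cyclic_onE tG).
rewrite count_map /= !cE //.
case: p sp {up ap lt7 fI fx xf cE} @f => [|? [|? [|? [|? [|? [|? [|? []]]]]]]] // _ /=.
by rewrite !addnA addn0.
Qed.

Lemma few_cyclic_large k c B : adm k -> 2 < k -> 0 < B -> few_cyclic k c ->
  exists m0, forall m, m0 <= m -> adm m -> exists n s,
  [/\ few_cyclic m (n * c + s), n * (k * k.-1) + s * 6 = m * m.-1
    & (B - 1) * m ^ 2 <= B * (n * k ^ 2)].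
Proof.
move=> ak k3 B0 D; have [m0 h] := main_design ak k3 B0; exists m0 => m m0m am.
have [n [[L [M [bL bM sL cov]]] bnd]] := h m m0m am.
exists n, (size M); split=> //; last first.
  by have := dec_size bL bM sL cov; rewrite card_ord.
move=> G tG.
have [b bIL|N [tN cN]] := @assemble _ G L M (fun _ => c) cov bM.
  have /andP[u /eqP s] := allP bL b bIL.
  exact: few_cyclic_block D tG u s.
have [S [tS cS]] := triples_set G tN; exists S; split=> //.
apply: leq_trans cS (leq_trans cN _).
by rewrite leq_add2r big_const_seq count_predT iter_addn_0 sL mulnC.
Qed.

(** Under a random permutation of the points each block of the design becomes a uniformly random
    injective 7-tuple, so some permutation does no worse than the average of [fano_average]. *)
Lemma few_cyclic_average m n : pbd 7 n m -> n * 42 = m * m.-1 -> 7 <= m ->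
  exists c, few_cyclic m c /\ 14 * (c * m ^_ 7) <= n * (13 * m ^_ 7 + 91 * (91 * m ^ 6)).
Proof.
move=> [L [M [bL bM sL cov]]] n42 m7.
(* The 7-sets already account for all pairs, so no triple is left over to be charged as cyclic. *)
have M0 : M = [::].
  have := dec_size bL bM sL cov; rewrite card_ord -n42 => /eqP.
  by rewrite -[X in _ == X]addn0 eqn_add2l muln_eq0 orbF => /eqP/size0nil.
case: m m7 L M bL bM sL cov M0 n42 => // m m7 L M bL _ sL cov M0 n42; subst M.
have f0 : 0 < 14 * m.+1 ^_ 7 by rewrite muln_gt0 ffact_gt0.
set X := n * _; exists (X %/ (14 * m.+1 ^_ 7)); split; last first.
  by rewrite mulnCA; apply: leq_trunc_div.
move=> G tG; have [p [pP pS]] := fano_average ord0 tG.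
rewrite card_ord in pS.
pose F (x : 7.-tuple 'I_m.+1) := fano_cyclic (tuple_rel G ord0 x) (p x).
(* [F] is extended to lists in order to be summed over blocks; these all have size 7, so the default
   0 does not occur. *)
pose Fs (y : seq 'I_m.+1) := if insub y is Some x then F x else 0.
have FsE (x : 7.-tuple 'I_m.+1) : Fs x = F x by rewrite /Fs valK.
pose W (s : {perm 'I_m.+1}) := \sum_(b <- L) Fs (map s b).
have sumW : (\sum_s W s) * m.+1 ^_ 7 =
    n * (#|{perm 'I_m.+1}| * \sum_(x : 7.-tuple 'I_m.+1 | uniq x) F x).
  rewrite /W exchange_big /= big_distrl /= big_seq (eq_bigr (fun _ =>
    #|{perm 'I_m.+1}| * \sum_(x : 7.-tuple 'I_m.+1 | uniq x) F x)) => [|b bIL].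
    by rewrite -big_seq big_const_seq count_predT iter_addn_0 sL mulnC.
  have /andP[u s7] := allP bL b bIL.
  have := @perm_average _ 7 F (Tuple s7) u; rewrite card_ord => <-.
  by congr (_ * _); apply: eq_bigr => s _; rewrite -FsE.
have [s sW] : exists s, 14 * (W s * m.+1 ^_ 7) <= X.
  case: (boolP [exists s, 14 * (W s * m.+1 ^_ 7) <= X]) => [/existsP//|].
  rewrite negb_exists => /forallP h.
  have : \sum_(s : {perm 'I_m.+1}) X < \sum_s 14 * (W s * m.+1 ^_ 7).
    rewrite [X in _ < X](eq_bigr (fun s => X.+1 + (14 * (W s * m.+1 ^_ 7) - X.+1))) => [|s _].
      rewrite big_split /= !sum_nat_const mulnS.
      have : 0 < #|{perm 'I_m.+1}| by apply/card_gt0P; exists 1%g.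
      by move: #|_| (#|_| * X) (\sum_(i | _) _) => a b d; lia.
    by rewrite subnKC // ltnNge; apply: h.
  have -> : \sum_s 14 * (W s * m.+1 ^_ 7) = 14 * ((\sum_s W s) * m.+1 ^_ 7).
    by rewrite big_distrl big_distrr.
  rewrite sumW sum_nat_const ltnNge => /negP[].
  rewrite /X mulnCA [X in _ <= X]mulnCA leq_mul2l; apply/orP; right.
  by rewrite mulnCA leq_mul2l; apply/orP; right.
have sI := @perm_inj _ s.
have cov' x y : x != y -> cover (map (map s) L) x y + cover [::] x y = 1.
  move=> xy; rewrite -[x](permKV s) -[y](permKV s) cover_map // {2}/cover big_nil.
  have := cov (s^-1 x)%g (s^-1 y)%g; rewrite {2}/cover big_nil; apply.
  by apply: contra xy => /eqP/perm_inj->.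
have [b|N [tN cN]] := @assemble _ G (map (map s) L) [::] Fs cov' isT.
  move=> /mapP[b' bIL ->]; have /andP[u s7] := allP bL b' bIL.
  have us : uniq (map s b') by rewrite map_inj_uniq.
  have ss : size (map s b') == 7 by rewrite size_map.
  have [N [h1 h2 h3]] := fano_block ord0 tG us (eqP ss) (pP (Tuple ss) us).
  exists N; split=> //; rewrite h3.
  by rewrite -[map s b']/(val (Tuple ss)) FsE.
have [S [tS cS]] := triples_set G tN; exists S; split=> //.
apply: leq_trans cS (leq_trans cN _); rewrite addn0 big_map.
by rewrite leq_divRL // mulnCA.
Qed.

Lemma few_cyclic_exp7 d (m := 7 ^ d.+1) : exists n c,
  [/\ few_cyclic m c, n * 42 = m * m.-1
    & 14 * (c * m ^_ 7) <= n * (13 * m ^_ 7 + 91 * (91 * m ^ 6))].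
Proof.
have [n [P E]] := pbd_exp7 d.
have [|c [h1 h2]] := few_cyclic_average P E; last by exists n, c.
by rewrite -[7 in leqLHS]expn1 leq_exp2l.
Qed.

(** * The limit *)

Local Open Scope ring_scope.

Lemma admP m : reflect (adm m) (admissible m).
Proof.
rewrite /admissible /adm (modn_small (isT : 1 < 6)%N) (modn_small (isT : 3 < 6)%N).
by apply: (iffP orP) => -[h|h]; [left|right|left|right]; apply/eqP.
Qed.

Lemma admissible_floorP n : (0 < n)%N -> admissible (admissible_floor n).
Proof.
move=> n0; rewrite /admissible_floor.
have [|i Pi ->] := @eq_bigmax_cond _ (fun m : 'I_n.+1 => admissible m) (fun m => m : nat).
  by apply/card_gt0P; exists (inord 1); rewrite unfold_in inordK.
by [].
Qed.

Lemma admissible_floor_ge N n : (N + 6 <= n)%N -> (N <= admissible_floor n)%N.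
Proof.
(* The witness is the number congruent to 1 modulo 6 among N + 1, ..., N + 6. *)
move=> h; have kn : (N + 6 - (N + 5) %% 6 < n.+1)%N by lia.
apply: leq_trans (_ : N + 6 - (N + 5) %% 6 <= _)%N; first by have := ltn_pmod (N + 5) (isT : 0 < 6)%N; lia.
apply: (@leq_bigmax_cond _ (fun m : 'I_n.+1 => admissible m) (fun m => m : nat) (Ordinal kn)).
apply/admP; left => /=; lia.
Qed.

Section Limit.
Variables (R : realType) (f : nat -> R).
Hypothesis f01 : forall k, adm k -> (2 < k)%N -> 0 <= f k <= 1.
Hypothesis f_large : forall k B, adm k -> (2 < k)%N -> (0 < B)%N ->
  exists m0, forall m, (m0 <= m)%N -> adm m -> (1 - B%:R^-1) * ((1 - k%:R^-1) * f k) <= f m.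

(** The limit is a supremum: a nearly optimal [k] bounds all later values from below, and each [f m]
    is bounded from above through its own member (1 - 1/m) f(m) of the family. *)
Lemma quasi_monotone_limit : exists S : R,
  (forall k, adm k -> (2 < k)%N -> (1 - k%:R^-1) * f k <= S) /\
  (forall e, 0 < e -> exists N, forall m, (N <= m)%N -> adm m -> `|S - f m| <= e).
Proof.
pose E := [set x | exists k, [/\ adm k, (2 < k)%N & x = (1 - k%:R^-1) * f k]].
have k1 k : (2 < k)%N -> 0 <= 1 - k%:R^-1 :> R /\ 1 - k%:R^-1 <= 1 :> R.
  move=> k3; have k0 : 0 < k%:R :> R by rewrite ltr0n; lia.
  rewrite subr_ge0 invf_le1 // ler1n gerBl invr_ge0 ltW //; split=> //; lia.
have Eub x : E x -> 0 <= x <= 1.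
  move=> [k [ak k3 ->]]; have [a b] := k1 k k3; have /andP[c d] := f01 ak k3.
  by rewrite mulr_ge0 //= mulr_ile1.
have E0 : E !=set0.
  exists ((1 - 3%:R^-1) * f 3); exists 3; split=> //; by right.
have hub : has_ubound E by exists 1 => x /Eub/andP[].
exists (sup E); split=> [k ak k3|e e0].
  by apply: ub_le_sup => //; exists k.
have e2 : 0 < e / 2 by rewrite divr_gt0.
have [x [k [ak k3 xE]] xS] := sup_adherent e2 (conj E0 hub).
(* [B] serves twice: 1/B is the loss in [f_large], and m >= B keeps the loss 1/m of the upper
   estimate below 1/B. Each is at most e/2. *)
pose B := (Num.bound `|2 / e|).+1.
have B0 : 0 < B%:R :> R by rewrite ltr0n.
have Be : B%:R^-1 <= e / 2.
  have : 2 / e <= B%:R.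
    apply: (le_trans (ler_norm _)); apply/ltW.
    apply: (lt_le_trans (archi_boundP _)); last by rewrite ler_nat.
    by rewrite normr_ge0.
  move=> h; rewrite -[e / 2]invrK lef_pV2 ?posrE ?invr_gt0 //.
  by rewrite invf_div.
have [m0 hm0] := f_large ak k3 (isT : (0 < B)%N).
exists (m0 + 3 + B)%N => m mN am.
have m3 : (2 < m)%N by lia.
have h1 : (1 - B%:R^-1) * x <= f m by rewrite xE; apply: hm0 => //; lia.
have h2 : (1 - m%:R^-1) * f m <= sup E by apply: ub_le_sup => //; exists m.
have mB : m%:R^-1 <= B%:R^-1 :> R.
  by rewrite lef_pV2 ?posrE ?ltr0n ?ler_nat //; lia.
have /andP[fm0 fm1] := f01 am m3.
have /andP[x0 x1] : 0 <= x <= 1 by apply: Eub; exists k.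
have m0' : 0 <= m%:R^-1 :> R by rewrite invr_ge0.
have B0' : 0 <= B%:R^-1 :> R by rewrite invr_ge0.
have h3 : m%:R^-1 * f m <= m%:R^-1 by rewrite ler_piMr.
have h4 : B%:R^-1 * x <= B%:R^-1 by rewrite ler_piMr.
rewrite mulrBl mul1r in h1; rewrite mulrBl mul1r in h2.
by rewrite ler_norml; apply/andP; split; lra.
Qed.
End Limit.

Lemma triangle_decomposition_card m (L : {set {set 'I_m}}) :
  triangle_decomposition L -> (#|L| * 6 = m * m.-1)%N.
Proof.
move=> tL; have [M [[bM cM] sM _]] := set_triples (fun _ _ => false) tL.
have := @dec_size 0 0 _ [::] M isT bM erefl.
by rewrite card_ord sM => <- // x y xy; rewrite {1}/cover big_nil cM.
Qed.

Lemma triangle_decomposition_gt0 m (L : {set {set 'I_m}}) : (2 < m)%N ->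
  triangle_decomposition L -> (0 < #|L|)%N.
Proof.
move=> m3 /triangle_decomposition_card; case: #|L| => // /esym/eqP.
by rewrite muln_eq0; lia.
Qed.

Lemma num_copies_T3 m (G : rel 'I_m) (L : {set {set 'I_m}}) : tournament G ->
  triangle_decomposition L -> (num_copies G T3 L + num_copies G C3 L = #|L|)%N.
Proof.
move=> tG [h3 _]; rewrite /num_copies !card_count.
rewrite (@eq_in_count _ _ (predC (is_copy G C3))) => [|t]; last first.
  by rewrite mem_enum => /h3 t3; rewrite /= triple_T3.
by rewrite addnC count_predC -cardE.
Qed.

Lemma tournament_ltn n : tournament (fun i j : 'I_n => (i < j)%N).
Proof.
by split=> [x|x y xy]; rewrite ?ltnn // -leqNgt ltn_neqAle xy.
Qed.

Lemma sts_exists m : adm m -> exists L : {set {set 'I_m}}, triangle_decomposition L.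
Proof.
move=> /(sts 0)[L [M [_ bM /size0nil L0 cM]]]; subst L.
have [|L [tL _]] := @triples_set _ (fun _ _ : 'I_m => false) M; last by exists L.
by split=> // x y xy; rewrite -(cM x y xy) /cover big_nil.
Qed.

(** * The minimum ratio in terms of cyclic triples *)

Section NuMin.
Variables (R : realType) (v : tri -> R).
Hypotheses (hT3 : v T3 = 1) (hC3 : v C3 = 0).

Lemma nu_decE m (G : rel 'I_m) L : (2 < m)%N -> tournament G -> triangle_decomposition L ->
  nu_dec v G L = 1 - 6 * (num_copies G C3 L)%:R / (m * m.-1)%:R.
Proof.
move=> m3 tG tL; rewrite /nu_dec hT3 hC3 mul1r mul0r addr0.
have L0 : (#|L|%:R : R) != 0.
  by rewrite pnatr_eq0 -lt0n (triangle_decomposition_gt0 m3).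
rewrite -(triangle_decomposition_card tL) natrM.
have -> : (num_copies G T3 L)%:R = #|L|%:R - (num_copies G C3 L)%:R :> R.
  by rewrite -(num_copies_T3 tG tL) natrD addrK.
rewrite mulrBl divff //; congr (1 - _).
by rewrite [_ * 6%:R]mulrC -mulf_div divff ?mul1r // pnatr_eq0.
Qed.

Lemma nu_dec_bounds m (G : rel 'I_m) L : (2 < m)%N -> tournament G ->
  triangle_decomposition L -> 0 <= nu_dec v G L <= 1.
Proof.
move=> m3 tG tL; rewrite /nu_dec hT3 hC3 mul1r mul0r addr0 divr_ge0 //=.
have L0 := triangle_decomposition_gt0 m3 tL.
by rewrite ler_pdivrMr ?ltr0n // mul1r ler_nat -(num_copies_T3 tG tL) leq_addr.
Qed.

Lemma nu_tournament_bounds m (G : rel 'I_m) : (2 < m)%N -> adm m -> tournament G ->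
  0 <= nu_tournament v G <= 1.
Proof.
move=> m3 am tG; have [L tL] := sts_exists am.
have inE' : [set nu_dec v G L' | L' in [set L' | triangle_decomposition L']] (nu_dec v G L).
  by exists L.
apply/andP; split.
  apply: (le_trans (proj1 (andP (nu_dec_bounds m3 tG tL)))); apply: ub_le_sup => //.
  by exists 1 => _ [L' tL' <-]; have /andP[] := nu_dec_bounds m3 tG tL'.
apply: ge_sup; first by exists (nu_dec v G L).
by move=> _ [L' tL' <-]; have /andP[] := nu_dec_bounds m3 tG tL'.
Qed.

Lemma nu_min_ge m c : (2 < m)%N -> few_cyclic m c ->
  1 - 6 * c%:R / (m * m.-1)%:R <= nu_min v m.
Proof.
move=> m3 D; apply: lb_le_inf.
  by exists (nu_tournament v (fun i j : 'I_m => (i < j)%N)); exists (fun i j : 'I_m => (i < j)%N);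
    [apply: tournament_ltn|].
move=> _ [G tG <-]; have [L [tL cL]] := D G tG.
apply: (@le_trans _ _ (nu_dec v G L)).
  rewrite nu_decE // lerD2l lerN2 ler_wpM2r ?invr_ge0 // ler_wpM2l // ler_nat //.
apply: ub_le_sup; last by exists L.
by exists 1 => _ [L' tL' <-]; have /andP[] := nu_dec_bounds m3 tG tL'.
Qed.

Lemma nu_min_le m c (G : rel 'I_m) : (2 < m)%N -> adm m -> tournament G ->
  (forall L, triangle_decomposition L -> (c <= num_copies G C3 L)%N) ->
  nu_min v m <= 1 - 6 * c%:R / (m * m.-1)%:R.
Proof.
move=> m3 am tG h; have [L0 tL0] := sts_exists am.
apply: (@le_trans _ _ (nu_tournament v G)).
  apply: ge_inf; last by exists G.
  by exists 0 => _ [G' tG' <-]; have /andP[] := nu_tournament_bounds m3 am tG'.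
apply: ge_sup; first by exists (nu_dec v G L0); exists L0.
move=> _ [L tL <-]; rewrite nu_decE // lerD2l lerN2 ler_wpM2r ?invr_ge0 //.
by rewrite ler_wpM2l // ler_nat h.
Qed.

(** The least [c] is attained: as [c - 1] fails, some tournament has at least [c] cyclic triples in
    every decomposition. *)
Lemma nu_min_few_cyclic m : (2 < m)%N -> adm m ->
  exists2 c, few_cyclic m c & nu_min v m = 1 - 6 * c%:R / (m * m.-1)%:R.
Proof.
move=> m3 am; have [c0 h0] : exists c, `[< few_cyclic m c >].
  exists (m * m.-1)%N; apply/asboolP => G tG; have [L tL] := sts_exists am.
  exists L; split=> //; have := num_copies_T3 tG tL; have := triangle_decomposition_card tL.
  lia.
have [c /asboolP Dc cmin] := ex_minnP (ex_intro (fun c => `[< few_cyclic m c >]) c0 h0).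
exists c => //; apply/eqP; rewrite eq_le nu_min_ge // andbT.
have [G tG hG] : exists2 G : rel 'I_m, tournament G &
    forall L, triangle_decomposition L -> (c <= num_copies G C3 L)%N.
  case: c Dc cmin => [|c] Dc cmin; first by exists (fun i j => (i < j)%N); [exact: tournament_ltn|].
  apply: contrapT => nh; suff /asboolP/cmin : few_cyclic m c by rewrite ltnn.
  move=> G tG; apply: contrapT => nL; apply: nh; exists G => // L tL.
  by rewrite ltnNge; apply/negP => cL; apply: nL; exists L.
exact: nu_min_le hG.
Qed.

Lemma nu_min_bounds m : (2 < m)%N -> adm m -> 0 <= nu_min v m <= 1.
Proof.
move=> m3 am; have tL := @tournament_ltn m.
have inn : [set nu_tournament v G | G in [set G : rel 'I_m | tournament G]]
    (nu_tournament v (fun i j : 'I_m => (i < j)%N)) by exists (fun i j => (i < j)%N).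
apply/andP; split.
  apply: lb_le_inf; first by exists (nu_tournament v (fun i j : 'I_m => (i < j)%N)).
  by move=> _ [G tG <-]; have /andP[] := nu_tournament_bounds m3 am tG.
apply: (le_trans (ge_inf _ inn)); last by have /andP[] := nu_tournament_bounds m3 am tL.
by exists 0 => _ [G' tG' <-]; have /andP[] := nu_tournament_bounds m3 am tG'.
Qed.

(** The ordered pairs inside k-sets number n k(k - 1), and there the ratio [nu_min v k] is retained;
    the remaining triples count as zero. Writing k(k - 1) as k^2 (1 - 1/k) produces the second
    factor. *)
Lemma nu_min_large k B : adm k -> (2 < k)%N -> (0 < B)%N ->
  exists m0, forall m, (m0 <= m)%N -> adm m ->
    (1 - B%:R^-1) * ((1 - k%:R^-1) * nu_min v k) <= nu_min v m.
Proof.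
move=> ak k3 B0; have [c Dc fk] := nu_min_few_cyclic k3 ak.
have [m0 h] := few_cyclic_large ak k3 B0 Dc; exists (m0 + 3)%N => m mm am.
have m3 : (2 < m)%N by lia.
have [|n [s [Dm E bnd]]] := h m _ am; first by lia.
apply: le_trans (nu_min_ge m3 Dm).
have /andP[f0 f1] := nu_min_bounds k3 ak.
set f := nu_min v k in fk f0 f1 *.
have kk : 0 < (k * k.-1)%:R :> R by rewrite ltr0n; nia.
have mm1 : 0 < (m * m.-1)%:R :> R by rewrite ltr0n; nia.
have cE : 6 * c%:R = (1 - f) * (k * k.-1)%:R :> R by rewrite fk subKr divfK // gt_eqF.
have ER : n%:R * (k * k.-1)%:R + s%:R * 6 = (m * m.-1)%:R :> R.
  by rewrite -E natrD !natrM.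
have bR : (B%:R - 1) * m%:R ^+ 2 <= B%:R * (n%:R * k%:R ^+ 2) :> R.
  move: bnd; rewrite -(ler_nat R) [X in X <= _]natrM [X in _ <= X]natrM [(n * _)%:R]natrM.
  by rewrite !natrX natrB.
have mm0 : (m * m.-1)%:R != 0 :> R by rewrite gt_eqF.
have -> : 1 - 6 * (n * c + s)%:R / (m * m.-1)%:R = n%:R * (k * k.-1)%:R * f / (m * m.-1)%:R :> R.
  rewrite -[X in X - _](divff mm0) -mulrBl; congr (_ / _).
  rewrite -ER natrD [(n * c)%:R]natrM; move: cE; set c' := c%:R; set K := (k * k.-1)%:R.
  set n' := n%:R; set s' := s%:R => cE.
  have -> : 6 * (n' * c' + s') = n' * (6 * c') + s' * 6 by lra.
  by rewrite cE; lra.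
rewrite ler_pdivlMr //.
have k0 : 0 < k%:R :> R by rewrite ltr0n; lia.
have Bp : 0 < B%:R :> R by rewrite ltr0n.
have kE : (k * k.-1)%:R = k%:R ^+ 2 * (1 - k%:R^-1) :> R.
  have -> : k.-1 = (k - 1)%N by lia.
  rewrite natrM natrB; last by lia.
  by rewrite expr2 -mulrA [k%:R * (1 - _)]mulrBr mulr1 divff // gt_eqF.
have a0 : 0 <= 1 - k%:R^-1 :> R by rewrite subr_ge0 invf_le1 // ler1n; lia.
have b0 : 0 <= 1 - B%:R^-1 :> R by rewrite subr_ge0 invf_le1 // ler1n.
have P2 : (m * m.-1)%:R <= m%:R ^+ 2 :> R.
  by rewrite -natrX ler_nat expnS expn1 leq_mul2l leq_pred orbT.
have bR' : (1 - B%:R^-1) * m%:R ^+ 2 <= n%:R * k%:R ^+ 2 :> R.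
  rewrite -(ler_pM2l Bp) mulrA mulrBr mulr1 divff //.
  by rewrite gt_eqF.
set g := (1 - k%:R^-1) * f.
have g0 : 0 <= g by rewrite mulr_ge0.
have -> : n%:R * (k * k.-1)%:R * f = n%:R * k%:R ^+ 2 * g by rewrite kE /g !mulrA.
apply: le_trans (ler_wpM2r g0 bR').
by rewrite mulrAC ler_wpM2r // ler_wpM2l.
Qed.

(** The main term is 1 - 13/98. Bounding k^6 by twice the falling factorial over k turns the error
    into 2 * 91 * 91 / 98 = 169 over k. *)
Lemma nu_min_exp7 d (k := (7 ^ d.+3)%N) : 85 / 98 - 169 / k%:R <= nu_min v k.
Proof.
have [n [c [Dc E bnd]]] := few_cyclic_exp7 d.+2; rewrite -/k in Dc E bnd.
have k42 : (42 <= k)%N.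
  apply: (@leq_trans (7 ^ 3)) => //; by rewrite leq_exp2l.
have k3 : (2 < k)%N by lia.
apply: le_trans (nu_min_ge k3 Dc).
(* Since 42 = 2 * 21, at most half of the 7-tuples have a repetition. *)
have ff : (k * k ^ 6 <= 2 * k ^_ 7)%N.
  have := expn_ffact k 6; rewrite -expnS.
  have : (42 * k ^ 6 <= k ^ 7)%N by rewrite expnS leq_mul2r k42 orbT.
  rewrite [X in (_ <= _ + X * _)%N -> _](_ : _ = 21)%N //.
  by move: (k ^ 7)%N (k ^ 6)%N (k ^_ 7)%N => x y z; lia.
have F0 : 0 < (k ^_ 7)%:R :> R by rewrite ltr0n ffact_gt0; lia.
have k0 : 0 < k%:R :> R by rewrite ltr0n; lia.
have n0 : 0 < n%:R :> R.
  by rewrite ltr0n; case: (n) E => // /esym/eqP; rewrite muln_eq0; lia.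
have ffR : (k ^ 6)%:R <= 2 * (k ^_ 7)%:R / k%:R :> R.
  by rewrite ler_pdivlMr // mulrC -!natrM ler_nat.
have bR : 14 * c%:R * (k ^_ 7)%:R <= n%:R * (13 * (k ^_ 7)%:R + 91 * (91 * (k ^ 6)%:R)) :> R.
  by rewrite -!natrM -natrD -natrM ler_nat -mulnA.
have h : 14 * c%:R <= n%:R * (13 + 91 * (91 * (2 / k%:R))) :> R.
  rewrite -(ler_pM2r F0); apply: le_trans bR _.
  rewrite -[X in _ <= X]mulrA ler_pM2l //; move: ffR; rewrite mulrAC.
  move: (2 / _) (k ^ 6)%:R (k ^_ 7)%:R => w y z; lra.
rewrite -E natrM; have -> : 6 * c%:R / (n%:R * 42) = 14 * c%:R / n%:R / 98 :> R.
  by rewrite invfM; lra.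
have : 14 * c%:R / n%:R <= 13 + 91 * (91 * (2 / k%:R)) :> R by rewrite ler_pdivrMr // [X in _ <= X]mulrC.
by lra.
Qed.
End NuMin.

Local Open Scope classical_set_scope.
Local Open Scope ring_scope.

Lemma exp7_adm d : adm (7 ^ d).
Proof. by left; rewrite -modnXm exp1n. Qed.

Theorem theorem3p2 (R : realType) (v : tri -> R)
    (hT3 : v T3 = 1) (hC3 : v C3 = 0) :
  [/\ cvgn (nu_seq v),
      85 / 98 <= nu v
    & exists eps : nat -> R,
        eps n @[n --> \oo] --> (0 : R) /\
        forall n : nat, admissible n ->
        forall G : rel 'I_n, tournament G ->
        exists L : {set {set 'I_n}},
          triangle_decomposition L /\
          (num_copies G C3 L)%:R
            <= 13 / (98 * 6) * n%:R ^+ 2 * (1 + eps n) ].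
Proof.
have [S [S_ge S_lim]] := quasi_monotone_limit
  (fun k ak k3 => nu_min_bounds hT3 hC3 k3 ak) (@nu_min_large R v hT3 hC3).
have seqE n : (0 < n)%N -> exists2 m, adm m &
    nu_seq v n = nu_min v m /\ (forall N, (N + 6 <= n)%N -> (N <= m)%N).
  move=> n0; rewrite /nu_seq; case: ifP => an.
    by exists n; [apply/admP | split=> // N; lia].
  exists (admissible_floor n); first by apply/admP/admissible_floorP.
  by split=> // N; apply: admissible_floor_ge.
have cv : nu_seq v @ \oo --> S.
  apply/cvgrPdist_le => e e0; have [N hN] := S_lim e e0.
  exists (N + 6)%N => // n /= Nn; have [|m am [-> hm]] := seqE n; first by lia.
  by apply: hN => //; apply: hm.
have nuE : nu v = S by apply: cvg_lim.
have S_big : 85 / 98 <= S.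
  apply/ler_addgt0Pr => e e0.
  (* 170 = 169 + 1: the error of [nu_min_exp7] and the loss 1/k in passing to the supremum. *)
  pose d := Num.bound (170 / e).
  have dk : 170 / e <= (7 ^ d.+3)%:R.
    apply: (le_trans (ltW (archi_boundP _))); first by rewrite divr_ge0 // ltW.
    rewrite ler_nat; apply: (leq_trans (ltnW (ltn_expl d (isT : 1 < 7)%N))).
    by rewrite leq_exp2l //; lia.
  have k0 : 0 < (7 ^ d.+3)%:R :> R by rewrite ltr0n expn_gt0.
  have k3 : (2 < 7 ^ d.+3)%N by apply: (@leq_trans (7 ^ 1)) => //; rewrite leq_exp2l.
  have h1 : 85 / 98 - 169 / (7 ^ d.+3)%:R <= nu_min v (7 ^ d.+3) := nu_min_exp7 hT3 hC3 d.
  have h2 := S_ge _ (exp7_adm d.+3) k3.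
  have /andP[f0 f1] := nu_min_bounds hT3 hC3 k3 (exp7_adm d.+3).
  have h3 : 170 / (7 ^ d.+3)%:R <= e by rewrite ler_pdivrMr // mulrC -ler_pdivrMr.
  move: h1 h2 f0 f1 h3; move: (nu_min v _) ((7 ^ d.+3)%:R) k0 => f k k0 h1 h2 f0 f1 h3.
  have : k^-1 * f <= k^-1 by rewrite ler_piMr // invr_ge0 ltW.
  rewrite mulrBl mul1r in h2; lra.
split; first by apply/cvg_ex; exists S.
  by rewrite nuE.
(* The number of cyclic triples is at most (13/98 + |S - f|) n^2/6; taking out 13/98 produces the
   factor 98/13. *)
exists (fun n => `|S - nu_seq v n| * (98 / 13)); split.
  have c0 : (S - nu_seq v n) @[n --> \oo] --> (0 : R).
    rewrite -(subrr S); apply: cvgB; [exact: cvg_cst | exact: cv].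
  have c1 : `|S - nu_seq v n| @[n --> \oo] --> (0 : R).
    exact/(@norm_cvg0P R R).
  rewrite -[X in _ --> X](mul0r (98 / 13)); exact: cvgMr_tmp.
move=> n an G tG; have [n3|n3] := ltnP 2 n.
  have [c Dc fE] := nu_min_few_cyclic hT3 hC3 n3 (elimT (admP n) an).
  have [L [tL cL]] := Dc G tG; exists L; split=> //.
  apply: (@le_trans _ _ c%:R); first by rewrite ler_nat.
  rewrite /nu_seq an; set f := nu_min v n in fE *.
  have P0 : 0 < (n * n.-1)%:R :> R by rewrite ltr0n muln_gt0; lia.
  have cE : c%:R = (1 - f) * (n * n.-1)%:R / 6 :> R.
    by rewrite fE subKr divfK ?gt_eqF // mulrC mulKf.
  have P2 : (n * n.-1)%:R <= n%:R ^+ 2 :> R.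
    by rewrite -natrX ler_nat expnS expn1 leq_mul2l leq_pred orbT.
  have h : 1 - f <= 13 / 98 + `|S - f|.
    have := ler_norm (S - f). lra.
  have h0 : 0 <= 13 / 98 + `|S - f| by rewrite addr_ge0.
  have : (1 - f) * (n * n.-1)%:R <= (13 / 98 + `|S - f|) * n%:R ^+ 2.
    by apply: (le_trans (ler_wpM2r (ltW P0) h)); apply: ler_wpM2l.
  rewrite cE; move: (n * n.-1)%:R (n%:R ^+ 2) `|S - f| => x y z; lra.
(* The only admissible size below 3 is 1, where the decomposition is empty. *)
have am := elimT (admP n) an; have n1 : n = 1%N by case: am; case: (n) n3 => [|[|[|]]].
have [L tL] := sts_exists am; exists L; split=> //.
have -> : num_copies G C3 L = 0%N.
  have := triangle_decomposition_card tL; have := num_copies_T3 tG tL.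
  have -> : (n * n.-1 = 0)%N by rewrite n1.
  by lia.
by rewrite mulr_ge0 // ?mulr_ge0 ?addr_ge0 ?mulr_ge0 // ?exprn_ge0 //; lra.
Qed.
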